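(* Let $K$ be a field, $S=K[x_1,\ldots,x_n]$ a standard graded polynomial ring, and let $e,d$ be integers with $2\leq e\leq d$. Let $I\subseteq S$ be a monomial ideal all of whose minimal monomial generators have degree between $e$ and $d$ (inclusive). Put $R=S/I$, $p=\operatorname{pd}_S R$, $t_i=t_i(R)$ and $\delta_i=di-t_i$ for $0\le i\le p$. If $t_a<ae$ for some integer $a$ with $2\leq a\leq p$, then, for every integer $b$ with $0\leq b\leq p-a$, $$\delta_{a+b}\geq\delta_a+\left\lfloor\frac b2\right\rfloor\geq a(d-e)+1+\left\lfloor\frac b2\right\rfloor.$$ In particular, $$t_{a+b}\leq ae+db-1-\left\lfloor\frac b2\right\rfloor.$$
   Context: For a graded quotient $R=S/I$, let $\beta^S_{i,j}(R)=\dim_K \operatorname{Tor}^S_i(R,K)_j$ be its graded Betti numbers and $\operatorname{pd}_S R$ its projective dimension over $S$. For $0\leq i\leq \operatorname{pd}_S R$, the $i$-th maximal shift is $t_i(R)=\max\{j:\beta^S_{i,j}(R)\neq 0\}$ (with $t_0(R)=0$). *)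

(* Defs.v *)
From HB Require Import structures.
From mathcomp Require Import all_boot all_order all_algebra generic_quotient ring_quotient.
From mathcomp Require Import mpoly.

Set Implicit Arguments.
Unset Strict Implicit.
Unset Printing Implicit Defensive.

Import Order.TTheory GRing.Theory Num.Theory.
Local Open Scope ring_scope.
Local Open Scope quotient_scope.

Section MonomialIdeal.
Variables (K : fieldType) (n : nat).

Definition in_monomial_span (A : 'X_{1..n} -> Prop) (f : {mpoly K[n]}) : Prop :=
  exists s : seq ({mpoly K[n]} * 'X_{1..n}),
    (forall u, u \in s -> A u.2) /\ f = \sum_(u <- s) u.1 * 'X_[u.2].

Definition monomial_ideal (I : {pred {mpoly K[n]}}) : Prop :=
  exists A : 'X_{1..n} -> Prop,
    forall f : {mpoly K[n]}, f \in I <-> in_monomial_span A f.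

Definition minimal_generator (I : {pred {mpoly K[n]}}) (m : 'X_{1..n}) : Prop :=
  'X_[m] \in I /\
  forall m' : 'X_{1..n}, (m' <= m)%MM -> 'X_[m'] \in I -> m' = m.

End MonomialIdeal.

(* An idealr is a proper ideal.  The unit ideal has minimal generator 1, of
   degree 0, so a lower bound 2 on generator degrees excludes it anyway. *)
Section QuotientModule.
Variables (S : comNzRingType) (I : idealr S).

Definition quot_module : Type := {ideal_quot I}.

HB.instance Definition _ := GRing.Zmodule.on quot_module.

Definition quot_class (f : S) : quot_module := \pi_({ideal_quot I}) f.

Definition quot_scale (f : S) (x : quot_module) : quot_module :=
  (\pi_({ideal_quot I}) f * (x : {ideal_quot I}) : {ideal_quot I}).

Fact quot_scaleA f g x : quot_scale f (quot_scale g x) = quot_scale (f * g) x.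
Proof. by rewrite /quot_scale mulrA rmorphM. Qed.

Fact quot_scale1 : left_id 1 quot_scale.
Proof. by move=> x; rewrite /quot_scale rmorph1 mul1r. Qed.

Fact quot_scaleDr : right_distributive quot_scale +%R.
Proof. by move=> f x y; rewrite /quot_scale mulrDr. Qed.

Fact quot_scaleDl x : {morph quot_scale^~ x : f g / f + g}.
Proof. by move=> f g; rewrite /quot_scale rmorphD mulrDl. Qed.

HB.instance Definition _ := GRing.Zmodule_isLmodule.Build S quot_module
  quot_scaleA quot_scale1 quot_scaleDr quot_scaleDl.

End QuotientModule.

Section ProjectiveDimension.
Variable S : comNzRingType.

Definition surjective_map (A B : Type) (f : A -> B) : Prop :=
  forall y, exists x, f x = y.

Definition projective (P : lmodType S) : Prop :=
  forall (M N : lmodType S) (g : {linear M -> N}) (f : {linear P -> N}),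
    surjective_map g -> exists h : {linear P -> M}, forall x, g (h x) = f x.

Definition projective_resolution_of_length (M : lmodType S) (p : nat) : Prop :=
  exists (P : nat -> lmodType S) (aug : {linear P 0%N -> M})
         (d : forall i, {linear P i.+1 -> P i}),
    [/\ forall i, projective (P i),
        forall i, (p < i)%N -> forall x : P i, x = 0,
        surjective_map aug,
        forall x : P 0%N, aug x = 0 <-> exists y, x = d 0%N y
      & forall i (x : P i.+1), d i x = 0 <-> exists y, x = d i.+1 y].

(* Intended for M != 0: a zero module would get dimension 0, not -oo. *)
Definition projective_dimension (M : lmodType S) (p : nat) : Prop :=
  projective_resolution_of_length M p /\
  forall q, projective_resolution_of_length M q -> (p <= q)%N.

End ProjectiveDimension.

Section Betti.
Variables (K : fieldType) (n : nat).
Local Notation S := {mpoly K[n]}.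

(* A resolution of M by finitely generated graded free modules
     F_i = \bigoplus_(k < gf_rank i) S(- gf_shift i k),
   whose elements are row vectors (shifts in nat suffice, as M lives in degrees
   >= 0); the differential F_(i+1) -> F_i is right
   multiplication by gf_diff i.  [piece j x] means that x is in M_j. *)
Record graded_free_resolution (M : lmodType S) (piece : nat -> M -> Prop) :=
  GradedFreeResolution {
  gf_rank : nat -> nat;
  gf_shift : forall i, 'I_(gf_rank i) -> nat;
  gf_diff : forall i, 'M[S]_(gf_rank i.+1, gf_rank i);
  gf_gen : 'I_(gf_rank 0) -> M;
  gf_diff_homog : forall i (k : 'I_(gf_rank i.+1)) (l : 'I_(gf_rank i)) m,
    m \in msupp (gf_diff i k l) -> (gf_shift l + mdeg m)%N = gf_shift k;
  gf_gen_homog : forall k, piece (gf_shift k) (gf_gen k);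
  gf_aug_surj : forall x : M, exists v : 'rV[S]_(gf_rank 0),
    \sum_k v 0 k *: gf_gen k = x;
  gf_exact0 : forall v : 'rV[S]_(gf_rank 0),
    \sum_k v 0 k *: gf_gen k = 0 <-> exists w, v = w *m gf_diff 0;
  gf_exact : forall i (v : 'rV[S]_(gf_rank i.+1)),
    v *m gf_diff i = 0 <-> exists w, v = w *m gf_diff i.+1
}.

Variables (M : lmodType S) (piece : nat -> M -> Prop).
Variable F : graded_free_resolution piece.

(* F_i \otimes_S K = K^(gf_rank i), as K = S/(x_1, ..., x_n): the differentials
   of F \otimes_S K are the matrices of constant coefficients. *)
Definition tensor_diff i : 'M[K]_(gf_rank F i.+1, gf_rank F i) :=
  map_mx (mcoeff 0%MM) (gf_diff F i).

(* The row space of tensor_piece i j is the degree j part of F_i \otimes_S K. *)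
Definition tensor_piece i (j : nat) : 'M[K]_(gf_rank F i) :=
  diag_mx (\row_k (gf_shift k == j)%:R).

Definition tensor_cycles i (j : nat) : 'M[K]_(gf_rank F i) :=
  match i with
  | 0 => tensor_piece 0 j
  | i'.+1 => (tensor_piece i'.+1 j :&: kermx (tensor_diff i'))%MS
  end.

Definition tensor_boundaries i (j : nat) : 'M[K]_(gf_rank F i.+1, gf_rank F i) :=
  tensor_piece i.+1 j *m tensor_diff i.

(* \dim_K Tor^S_i(M, K)_j = \dim_K H_i(F \otimes_S K)_j; the boundaries are
   contained in the cycles, so the subtraction is not truncated. *)
Definition betti i (j : nat) : nat :=
  (\rank (tensor_cycles i j) - \rank (tensor_boundaries i j))%N.

(* The maximum of all j with betti i j != 0: every such j is a shift of F_i, by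
   betti_neq0_shift.  It is 0 if there is no such j, i.e. if Tor_i(M, K) = 0. *)
Definition max_shift i : nat :=
  \max_(k < gf_rank F i | betti i (gf_shift k) != 0%N) gf_shift k.

Lemma betti_neq0_shift i j :
  betti i j != 0%N -> exists k : 'I_(gf_rank F i), gf_shift k = j.
Proof.
move=> bij; have [/existsP[k /eqP] | /existsPn noj] :=
  boolP [exists k : 'I_(gf_rank F i), gf_shift k == j]; first by exists k.
have p0 : tensor_piece i j = 0.
  apply/matrixP => k l; rewrite !mxE; have [->|_] := eqVneq k l => //.
  by rewrite (negPf (noj l)) mul0rn.
move: bij; rewrite /betti; suff -> : \rank (tensor_cycles i j) = 0%N by [].
apply/eqP; rewrite -leqn0 -(mxrank0 K (gf_rank F i) (gf_rank F i)) -p0.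
by apply: mxrankS; case: (i) => [|i'] /=; rewrite ?capmxSl.
Qed.

Lemma max_shift_ge i j : betti i j != 0%N -> (j <= max_shift i)%N.
Proof.
move=> bij; have [k kj] := betti_neq0_shift bij.
by rewrite -kj in bij *; apply: (@leq_bigmax_cond _ _ (@gf_shift _ _ F i)).
Qed.

Lemma max_shift_attained i j :
  betti i j != 0%N -> betti i (max_shift i) != 0%N.
Proof.
move=> bij; have [k kj] := betti_neq0_shift bij; rewrite -kj in bij.
pose P := [pred l : 'I_(gf_rank F i) | betti i (gf_shift l) != 0%N].
rewrite /max_shift (@bigop.bigmax_eq_arg _ k P (@gf_shift _ _ F i) bij).
by case: (@arg_maxnP _ k P (@gf_shift _ _ F i) bij).
Qed.

End Betti.

(* The standard grading of S/I for I homogeneous. *)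
Definition quot_piece (K : fieldType) (n : nat) (I : idealr {mpoly K[n]})
    (j : nat) (x : quot_module I) : Prop :=
  exists2 f : {mpoly K[n]}, f \is j.-homog & x = quot_class I f.

(* Main.v *)
From HB Require Import structures.
From Stdlib Require Import Classical.
Require Import Defs.
From mathcomp Require Import all_boot all_order all_algebra generic_quotient ring_quotient.
From mathcomp Require Import mpoly.
From mathcomp Require Import zify.

(* The multigraded Betti numbers of S/I are the homologies of the strands of
   the Taylor complex of the minimal generators g_x tensored with K: in
   multidegree m, the chains on the sets s of generators with lcm(s) = m.  The
   chains on the s with lcm(q, lcm(s)) = m similarly compute the Betti numbers
   of the colon ideal I : q.

   Peeling: if Tor_(c+1) lives in multidegree m and the generator u divides m,
   then Tor_c lives in some m' <> m with lcm(m', u) = m.  Hence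
   t_(c+1) <= t_c + d.  Suppose that t_(c+2) >= t_c + 2d, and let Tor_(c+2) live
   in m of degree t_(c+2).  For distinct generators u, z dividing m, put
   q = gcd(u, z).  As deg q < d, Tor_(c+2) of S/(I : q) still lives in m; peeling
   off u and then z, one finds Tor_c of S/I in a degree at least
   t_(c+2) - 2d + deg q, so q = 1.  So the generators dividing m are pairwise
   coprime and form a complete intersection with c + 2 elements, whence
   t_a >= ae for all a <= c + 2.  Thus t_a < ae implies t_(c+2) < t_c + 2d for
   all c + 2 >= a, and the gain of b/2 follows by induction on b. *)

Set Implicit Arguments.
Unset Strict Implicit.
Unset Printing Implicit Defensive.

Import Order.TTheory GRing.Theory Num.Theory.
Local Open Scope ring_scope.

(** * Chains on families of sets *)

Section SetChains.
Variables (K : comNzRingType) (N : nat).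
Implicit Types (s t : {set 'I_N}) (c w : {set 'I_N} -> K) (X Y : {set {set 'I_N}}).

Definition sgn (x : 'I_N) s : K := (-1) ^+ #|[set y in s | (y < x)%N]|.

Lemma sgnU1 x y s : y \notin s -> sgn x (y |: s) = (-1) ^+ (y < x)%N * sgn x s.
Proof.
move=> ys; rewrite /sgn -exprD; congr (_ ^+ _).
have [yx|xy] := boolP (y < x)%N.
  have -> : [set z in y |: s | (z < x)%N] = y |: [set z in s | (z < x)%N].
    by apply/setP => z; rewrite !inE; case: eqP => // ->; rewrite yx.
  by rewrite cardsU1 !inE (negPf ys).
by apply: eq_card => z; rewrite !inE; case: (z =P y) => //= ->; rewrite (negPf xy) !andbF.
Qed.

Lemma sgn_swap x y s : x != y -> x \notin s -> y \notin s ->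
  sgn x (y |: s) * sgn y s = - (sgn y (x |: s) * sgn x s).
Proof.
move=> xy xs ys; rewrite !sgnU1 // -!mulrA (mulrC (sgn y s)) -mulNr; congr (_ * _).
by move: xy; rewrite -val_eqE neq_ltn => /orP[] lt; rewrite lt ltnNge (ltnW lt) /=
  ?expr0 ?expr1 ?opprK.
Qed.

Lemma sgn_sq x s : sgn x s * sgn x s = 1.
Proof. by rewrite /sgn -expr2 -exprM mulnC exprM sqrrN expr1n expr1n. Qed.

Lemma sgn_cross x y s : x != y -> x \notin s -> y \notin s ->
  sgn x (y |: s) * sgn y (x |: s) = - (sgn y s * sgn x s).
Proof.
move=> xy xs ys; rewrite -[sgn x (y |: s)]mulr1 -(sgn_sq y s) mulrA sgn_swap //.
by rewrite !mulNr (mulrC (sgn y (x |: s))) -mulrA mulrAC -!mulrA sgn_sq mulr1 mulrC.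
Qed.

(** The simplicial boundary in terms of coefficients: the value at [s] collects the sets with one
    element more. The empty set counts as a face, so the complex is augmented. *)
Definition bd c s : K := \sum_(x | x \notin s) sgn x s * c (x |: s).

Lemma eq_bd c w s : c =1 w -> bd c s = bd w s.
Proof. by move=> e; apply: eq_bigr => x _; rewrite e. Qed.

Lemma bdD c w s : bd (fun r => c r + w r) s = bd c s + bd w s.
Proof. by rewrite -big_split; apply: eq_bigr => x _; rewrite mulrDr. Qed.

Lemma bdB c w s : bd (fun r => c r - w r) s = bd c s - bd w s.
Proof. by rewrite -sumrB; apply: eq_bigr => x _; rewrite mulrBr. Qed.

Lemma bd_bd c s : bd (bd c) s = 0.
Proof.
pose a x y := sgn x s * (sgn y (x |: s) * c (y |: (x |: s))).
pose P x y := [&& x \notin s, y \notin s & x != y].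
have aN x y : P x y -> a x y = - a y x.
  case/and3P => xs ys xy; rewrite /a !mulrA (mulrC (sgn x s)).
  rewrite sgn_swap 1?eq_sym // mulNr (mulrC (sgn y s)); congr (- (_ * c _)).
  by rewrite setUCA.
have -> : bd (bd c) s = \sum_x \sum_(y | P x y) a x y.
  rewrite /bd big_mkcond; apply: eq_bigr => x _; rewrite /P; case: ifP => xs; last first.
    by rewrite big_pred0.
  rewrite mulr_sumr; apply: eq_bigl => y.
  by rewrite !inE negb_or eq_sym andbC.
pose lt x y := P x y && (x < y)%N.
(* Antisymmetry alone only shows that twice the sum vanishes, which says nothing in characteristic
   2. So the pairs are split by the order of [x] and [y], and the two halves cancel. *)
have -> : \sum_x \sum_(y | P x y) a x y =
    \sum_x \sum_(y | lt x y) a x y + \sum_x \sum_(y | lt y x) a x y.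
  rewrite -big_split; apply: eq_bigr => x _ /=.
  rewrite (bigID (fun y : 'I_N => (x < y)%N)) /=; congr (_ + _).
  apply: eq_bigl => y; rewrite /lt /P (andbCA (x \notin s)) (eq_sym y); case: eqP => [->|/eqP] /=.
    by rewrite !andbF.
  by rewrite -val_eqE neq_ltn => /orP[] l; rewrite l ltnNge (ltnW l) /= ?andbT ?andbF.
rewrite [X in _ + X](exchange_big_dep predT) //= -big_split big1 // => x _ /=.
rewrite -big_split big1 // => y /andP[Pxy _] /=.
by rewrite aN // addNr.
Qed.

Definition chain_on X i c := forall s, c s != 0 -> (s \in X) && (#|s| == i).

(* For convex [X], the chains on [X] with the boundary cut off outside [X] form a
   subquotient of the augmented chain complex of the full simplex; [acyclic X i]
   says that its homology at the sets of cardinal [i] vanishes. *)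
Definition acyclic X i := forall c, chain_on X i c ->
  (forall s, s \in X -> bd c s = 0) ->
  exists2 w, chain_on X i.+1 w & forall s, s \in X -> bd w s = c s.

Definition convex X := forall r s t, r \in X -> t \in X ->
  r \subset s -> s \subset t -> s \in X.

Definition restr X c s := if s \in X then c s else 0.

Lemma chain_onS X Y i c : X \subset Y -> chain_on X i c -> chain_on Y i c.
Proof. by move=> /subsetP XY hc s /hc /andP[/XY -> ->]. Qed.

Lemma chain_onB X i c w : chain_on X i c -> chain_on X i w ->
  chain_on X i (fun s => c s - w s).
Proof.
move=> hc hw s; have [->|/hc//] := eqVneq (c s) 0.
by rewrite add0r oppr_eq0 => /hw.
Qed.

Lemma chain_onD X i c w : chain_on X i c -> chain_on X i w ->
  chain_on X i (fun s => c s + w s).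
Proof. by move=> hc hw s; have [->|/hc//] := eqVneq (c s) 0; rewrite add0r => /hw. Qed.

Lemma chain_on_out X i c s : chain_on X i c -> s \notin X -> c s = 0.
Proof. by move=> hc sX; apply/eqP/negPn/negP => /hc; rewrite (negPf sX). Qed.

Lemma chain_on_restr X Y i c : chain_on X i c -> chain_on (X :&: Y) i (restr Y c).
Proof.
move=> hc s; rewrite /restr in_setI; case: (s \in Y); last by rewrite eqxx.
by move=> /hc /andP[-> ->].
Qed.

Lemma chain_on_bd X i c : chain_on X i.+1 c -> chain_on X i (restr X (bd c)).
Proof.
move=> hc s; rewrite /restr; case: (s \in X); last by rewrite eqxx.
move=> nz /=; apply: contraNT nz => ns; rewrite /bd big1 // => x xs.
have [->|/hc] := eqVneq (c (x |: s)) 0; first by rewrite mulr0.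
by rewrite cardsU1 xs eqSS (negPf ns) andbF.
Qed.

(** A set between [s] and a face of the support of [c] lies in [X] by convexity, so the cut-off only
    drops coefficients of [bd c] that vanish. *)
Lemma bd_restr_bd X i c s : convex X -> chain_on X i c -> s \in X ->
  bd (restr X (bd c)) s = 0.
Proof.
move=> cX hc sX; rewrite -[RHS](bd_bd c s); apply: eq_bigr => x xs; congr (_ * _).
rewrite /restr; case: ifPn => // xsX; rewrite /bd big1 // => y _.
have [->|/hc/andP[h _]] := eqVneq (c (y |: (x |: s))) 0; first by rewrite mulr0.
by case/negP: xsX; apply: (cX s _ _ sX h); rewrite subsetUr.
Qed.

(** For convex [X], a down-closed [Y] carries a subcomplex of the chains on [X], with the chains on
    [X :\: Y] as quotient. If [Y] is also up-closed, it carries a direct summand. *)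
Definition down_closed X Y := forall s t, s \in Y -> t \in X -> t \subset s -> t \in Y.
Definition up_closed X Y := forall s t, s \in Y -> t \in X -> s \subset t -> t \in Y.

Lemma convexS X Y : convex X -> Y \subset X -> down_closed X Y -> convex Y.
Proof.
move=> cX /subsetP YX dY r s t rY tY rs st; apply: (dY t s tY) => //.
exact: cX (YX _ rY) (YX _ tY) rs st.
Qed.

Lemma bd_down X Y i w s : down_closed X Y -> s \in X -> s \notin Y -> chain_on Y i w ->
  bd w s = 0.
Proof.
move=> dY sX sY hw; rewrite /bd big1 // => x _.
have [->|/hw/andP[h _]] := eqVneq (w (x |: s)) 0; first by rewrite mulr0.
by case/negP: sY; apply: dY h sX (subsetUr _ _).
Qed.

Lemma bd_restr_diff X Y i c s : down_closed X Y -> s \in X :\: Y -> chain_on X i c ->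
  bd (restr (X :\: Y) c) s = bd c s.
Proof.
move=> dY /setDP[sX sY] hc; apply: eq_bigr => x xs; congr (_ * _).
rewrite /restr inE; case: ifPn => //; rewrite negb_and negbK => /orP[h|h]; last first.
  by rewrite (chain_on_out hc h).
by case/negP: sY; apply: dY h sX (subsetUr _ _).
Qed.

(** This is exactness of H_i(Y) -> H_i(X) -> H_i(X :\: Y) in the middle. *)
Lemma acyclic_glue X Y i : convex X -> Y \subset X -> down_closed X Y ->
  acyclic Y i -> acyclic (X :\: Y) i -> acyclic X i.
Proof.
move=> cX YX dY aY aZ c hc cc.
have hcZ : chain_on (X :\: Y) i (restr (X :\: Y) c).
  by have := chain_on_restr (Y := X :\: Y) hc; apply: chain_onS; apply: subsetIr.
case: (aZ _ hcZ) => [s sZ|w1 hw1 e1].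
  by rewrite (bd_restr_diff dY sZ hc) cc //; case/setDP: sZ.
have hw1X := chain_onS (subsetDl X Y) hw1.
(* A filling of [c] on the quotient, read as a chain on [X], corrects [c] to a cycle supported on
   [Y]. *)
pose c' s := c s - restr X (bd w1) s.
have hc' : chain_on Y i c'.
  move=> s nz; have /andP[sX si] := chain_onB hc (chain_on_bd hw1X) nz.
  rewrite si andbT; apply: contraNT nz => sY; have sZ : s \in X :\: Y by rewrite in_setD sY.
  by rewrite /c' /restr sX e1 // /restr sZ subrr.
case: (aY _ hc') => [s sY|w2 hw2 e2].
  have sX := subsetP YX _ sY.
  by rewrite bdB cc // (bd_restr_bd cX hw1X sX) subrr.
exists (fun s => w1 s + w2 s).
  by apply: chain_onD => //; apply: chain_onS hw2.
move=> s sX; rewrite bdD; have [sY|sY] := boolP (s \in Y).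
  by rewrite e2 // /c' /restr sX addrC subrK.
have sZ : s \in X :\: Y by rewrite in_setD sY.
by rewrite e1 // (bd_down dY sX sY hw2) addr0 /restr sZ.
Qed.

(** This is exactness of H_(i+1)(X) -> H_(i+1)(X :\: Y) -> H_i(Y) in the middle; the cut-off
    boundary of [c] represents its image under the connecting map. *)
Lemma acyclic_quot X Y i : convex X -> Y \subset X -> down_closed X Y ->
  acyclic X i.+1 -> acyclic Y i -> acyclic (X :\: Y) i.+1.
Proof.
move=> cX YX dY aX aY c hc cc.
have hcX := chain_onS (subsetDl X Y) hc.
have hb : chain_on Y i (restr X (bd c)).
  move=> s nz; have /andP[sX si] := chain_on_bd hcX nz.
  rewrite si andbT; apply: contraNT nz => sY.
  by rewrite /restr sX cc // in_setD sY.
case: (aY _ hb) => [s sY|w hw e].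
  by rewrite (bd_restr_bd cX hcX) // (subsetP YX).
have hwX := chain_onS YX hw.
case: (aX _ (chain_onB hcX hwX)) => [s sX|v hv ev].
  rewrite bdB; have [sY|sY] := boolP (s \in Y); first by rewrite e // /restr sX subrr.
  by rewrite cc ?in_setD ?sY // (bd_down dY sX sY hw) subrr.
exists (restr (X :\: Y) v).
  by have := chain_on_restr (Y := X :\: Y) hv; apply: chain_onS; apply: subsetIr.
move=> s sZ; rewrite (bd_restr_diff dY sZ hv); case/setDP: (sZ) => sX sY.
by rewrite ev // (chain_on_out hw sY) subr0.
Qed.

Lemma acyclic_summand X Y i : Y \subset X -> down_closed X Y -> up_closed X Y ->
  acyclic X i -> acyclic Y i.
Proof.
move=> YX dY uY aX c hc cc.
case: (aX _ (chain_onS YX hc)) => [s sX|w hw e].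
  have [/cc//|sY] := boolP (s \in Y); exact: bd_down dY sX sY hc.
exists (restr Y w).
  by have := chain_on_restr (Y := Y) hw; apply: chain_onS; apply: subsetIr.
move=> s sY; rewrite -e ?(subsetP YX) //; apply: eq_bigr => x xs; congr (_ * _).
rewrite /restr; case: ifPn => // h; apply/esym/eqP; apply: contraNT h => /hw /andP[h _].
exact: uY sY h (subsetUr _ _).
Qed.

Definition cone u c s := if u \in s then sgn u (s :\ u) * c (s :\ u) else 0.

(** Joining with the vertex [u] is a contracting homotopy of the augmented full simplex. *)
Lemma bd_cone u c s : bd (cone u c) s + cone u (bd c) s = c s.
Proof.
rewrite {2}/cone; case: ifPn => us; last first.
  rewrite addr0 /bd (bigD1 u) //= /cone big1 => [|x /andP[xs xu]].
    by rewrite !inE eqxx setU1K // addr0 mulrA sgn_sq mul1r.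
  by rewrite !inE (negPf us) eq_sym (negPf xu) mulr0.
pose r := s :\ u; have sE : s = u |: r by rewrite setD1K.
have ur : u \notin r by rewrite !inE eqxx.
rewrite -/r {2}/bd (bigD1 u) //= mulrDr !mulrA sgn_sq mul1r -sE.
rewrite addrCA -[RHS]addr0; congr (_ + _).
rewrite mulr_sumr /bd (eq_bigl (fun x => (x \notin r) && (x != u))); last first.
  by move=> x; rewrite {1}sE !inE negb_or andbC negb_and negbK;
     case: (x =P u) => [->|] //=; rewrite ?andbF.
rewrite -big_split big1 // => x /andP[xr xu] /=.
rewrite /cone !inE us orbT.
have -> : (x |: s) :\ u = x |: r.
  by rewrite {1}sE setUCA setU1K // in_setU1 negb_or ur andbT eq_sym.
by rewrite sE !mulrA -mulrDl sgn_cross // addNr mul0r.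
Qed.

Lemma chain_on_cone X u i c : (forall s, s \in X -> u |: s \in X) ->
  chain_on X i c -> chain_on X i.+1 (cone u c).
Proof.
move=> uX hc s; rewrite /cone; case: ifPn => [us|]; last by rewrite eqxx.
move=> nz.
have /hc/andP[h /eqP <-] : c (s :\ u) != 0.
  by apply: contraNneq nz => ->; rewrite mulr0.
have := uX _ h; rewrite setD1K // => -> /=.
by rewrite (cardsD1 u) us.
Qed.

(** The family is stable under inserting and deleting [u], so the contraction of the full simplex
    with apex [u] restricts to it. *)
Lemma acyclic_toggle X u i : (forall s, (u |: s \in X) = (s \in X)) -> acyclic X i.
Proof.
move=> uX c hc cc; exists (cone u c).
  by apply: chain_on_cone => // s; rewrite uX.
move=> s sX; rewrite -[RHS](bd_cone u).
suff -> : cone u (bd c) s = 0 by rewrite addr0.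
rewrite /cone; case: ifPn => // us.
by rewrite cc ?mulr0 // -uX setD1K.
Qed.

(** Filtration by [rk]: removing the fibre of a set of maximal rank leaves a down-closed family, so
    the fibres are glued one by one. In the applications [f] is an lcm and [rk] its degree. *)
Lemma acyclic_fibres (T : eqType) (f : {set 'I_N} -> T) (rk : T -> nat) X i :
    convex X ->
    (forall s t, s \in X -> t \in X -> s \subset t ->
       (rk (f s) <= rk (f t))%N /\ (rk (f s) = rk (f t) -> f s = f t)) ->
    (forall s, s \in X -> acyclic [set t in X | f t == f s] i) ->
  acyclic X i.
Proof.
have [k] := ubnP #|X|; elim: k X => // k IH X ltk cX fX aX.
have [X0|[s0 s0X]] := set_0Vmem X.
  by move=> c hc _; exists (fun _ => 0) => [s|s]; rewrite ?X0 ?inE // eqxx.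
case: (@arg_maxnP _ s0 (mem X) (rk \o f) s0X) => /= s sX smax.
pose Y := [set t in X | f t != f s].
have YX : Y \subset X by apply/subsetP => t; rewrite inE => /andP[].
have dY : down_closed X Y.
  move=> t r; rewrite !inE => /andP[tX tf] rX rt; rewrite rX; apply: contra tf => /eqP rf.
  have [le eq] := fX _ _ rX tX rt; apply/eqP; rewrite -rf; apply/esym/eq/eqP.
  by rewrite eqn_leq le rf; apply: smax.
have eZ : [set t in X | f t == f s] = X :\: Y.
  by apply/setP => t; rewrite !inE negb_and negbK; case: (t \in X); rewrite ?andbT ?andbF.
apply: (acyclic_glue cX YX dY); last by rewrite -eZ; apply: aX.
apply: IH.
- rewrite -ltnS; apply: leq_trans ltk; rewrite ltnS; apply: proper_card.
  by rewrite properE YX; apply/subsetPn; exists s => //; rewrite inE eqxx andbF.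
- exact: convexS cX YX dY.
- by move=> t r /(subsetP YX) tX /(subsetP YX) rX; apply: fX.
move=> t tY; have tX := subsetP YX _ tY.
have -> : [set r in Y | f r == f t] = [set r in X | f r == f t].
  apply/setP => r; rewrite !inE; case: (f r =P f t) => [->|_]; last by rewrite !andbF.
  by move: tY; rewrite inE => /andP[_ ->]; rewrite andbT.
exact: aX.
Qed.

End SetChains.

(** * Least common multiples and the strands of the Taylor complex *)

Section MonomialLattice.
Variable n : nat.
Implicit Types m a b : 'X_{1..n}.

Definition mgcd a b : 'X_{1..n} := [multinom minn (a i) (b i) | i < n].

Lemma mdeg_lcm_gcd a b : (mdeg (mlcm a b) + mdeg (mgcd a b) = mdeg a + mdeg b)%N.
Proof. by rewrite !mdegE -!big_split; apply: eq_bigr => i _; rewrite !mnmE /=; lia. Qed.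

Lemma lem_mgcdl a b : (mgcd a b <= a)%MM.
Proof. by apply/mnm_lepP => i; rewrite mnmE geq_minl. Qed.

Lemma lem_mgcdr a b : (mgcd a b <= b)%MM.
Proof. by apply/mnm_lepP => i; rewrite mnmE geq_minr. Qed.

Lemma lem_mgcd m a b : (m <= mgcd a b)%MM = (m <= a)%MM && (m <= b)%MM.
Proof.
apply/mnm_lepP/andP => [h|[/mnm_lepP ha /mnm_lepP hb] i]; last by rewrite mnmE leq_min ha hb.
by split; apply/mnm_lepP => i; have := h i; rewrite mnmE leq_min => /andP[].
Qed.

Lemma lem0 m : (0 <= m)%MM.
Proof. by apply/mnm_lepP => i; rewrite mnmE. Qed.

Lemma submm m : (m - m = 0)%MM.
Proof. by apply/mnmP => i; rewrite !mnmE subnn. Qed.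

Lemma lem_coef a b i : (a <= b)%MM -> (a i <= b i)%N.
Proof. by move/mnm_lepP. Qed.

Lemma lem_mdeg a b : (a <= b)%MM -> (mdeg a <= mdeg b)%N.
Proof. by move/mnm_lepP => h; rewrite !mdegE; apply: leq_sum. Qed.

Lemma lem_anti a b : (a <= b)%MM -> (b <= a)%MM -> a = b.
Proof.
by move=> /mnm_lepP h /mnm_lepP k; apply/mnmP => i; apply/eqP; rewrite eqn_leq h k.
Qed.

Lemma lem_mdeg_eq a b : (a <= b)%MM -> mdeg a = mdeg b -> a = b.
Proof.
move=> ab e; apply/mnmP => i; apply/eqP; rewrite eqn_leq (lem_coef _ ab) /=.
have := submK ab => sE; have : mdeg (b - a) = 0%N.
  by move: e; rewrite -[in RHS]sE mdegD; lia.
move/eqP; rewrite mdeg_eq0 => /eqP s0.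
by rewrite -sE s0 mnmDE mnmE.
Qed.

End MonomialLattice.

Section LcmComplex.
Variables (K : comNzRingType) (n N : nat) (g : 'I_N -> 'X_{1..n}).
Implicit Types (s t : {set 'I_N}) (q m : 'X_{1..n}).

Definition lcms s : 'X_{1..n} := [multinom (\max_(x in s) g x i)%N | i < n].

Lemma lem_lcms s m : reflect (forall x, x \in s -> (g x <= m)%MM) (lcms s <= m)%MM.
Proof.
apply: (iffP idP) => [/mnm_lepP h x xs|h].
  apply/mnm_lepP => i; apply: leq_trans (h i); rewrite mnmE.
  by rewrite (bigD1 x) //= leq_maxl.
apply/mnm_lepP => i; rewrite mnmE; apply/bigmax_leqP => x xs.
exact: lem_coef (h x xs).
Qed.

Lemma lcms_ge x s : x \in s -> (g x <= lcms s)%MM.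
Proof. by move: x; apply/lem_lcms; apply: lepm_refl. Qed.

Lemma lcmsS s t : s \subset t -> (lcms s <= lcms t)%MM.
Proof. by move/subsetP => st; apply/lem_lcms => x /st; apply: lcms_ge. Qed.

Lemma lcms0 : lcms set0 = 0%MM.
Proof. by apply: lem_anti; [apply/lem_lcms => x; rewrite inE | apply/mnm_lepP => i; rewrite mnmE]. Qed.

Lemma lcmsU1 x s : lcms (x |: s) = mlcm (g x) (lcms s).
Proof.
apply: lem_anti.
  apply/lem_lcms => y /setU1P[->|ys]; first exact: lem_mlcml.
  by apply: lepm_trans (lem_mlcmr _ _); apply: lcms_ge.
by rewrite lem_mlcm lcms_ge ?setU11 // lcmsS // subsetUr.
Qed.

(* The strand computing Tor(S/(I : q), K) in multidegree [m / q]. *)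
Definition lcm_fibre q m : {set {set 'I_N}} := [set s | mlcm q (lcms s) == m].

Local Notation acyc q m i := (acyclic K (lcm_fibre q m) i).

Lemma mlcmS q a b : (a <= b)%MM -> (mlcm q a <= mlcm q b)%MM.
Proof. by move=> ab; rewrite lem_mlcm lem_mlcml; apply: lepm_trans (lem_mlcmr _ _). Qed.

Lemma convex_lcm_fibre q m : convex (lcm_fibre q m).
Proof.
move=> r s t; rewrite !inE => /eqP rm /eqP tm rs st; apply/eqP/lem_anti.
  by rewrite -tm mlcmS // lcmsS.
by rewrite -rm mlcmS // lcmsS.
Qed.

Lemma lcm_fibre_mono q s t : s \subset t ->
  (mdeg (mlcm q (lcms s)) <= mdeg (mlcm q (lcms t)))%N /\
  (mdeg (mlcm q (lcms s)) = mdeg (mlcm q (lcms t)) -> mlcm q (lcms s) = mlcm q (lcms t)).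
Proof.
move=> st; have le : (mlcm q (lcms s) <= mlcm q (lcms t))%MM by rewrite mlcmS ?lcmsS.
by split; [apply: lem_mdeg | apply: lem_mdeg_eq].
Qed.

(* The family of the [s] with [lcm(q, u, lcm(s)) = m] is a cone with apex [u], and
   the strand of [m] is what is left of it after removing the strands of the
   [m' <> m] with [lcm(m', u) = m]. *)
Lemma lcm_fibre_peel q m u i : (g u <= m)%MM ->
  (forall m', (q <= m')%MM -> m' != m -> mlcm m' (g u) = m -> acyc q m' i) ->
  acyc q m i.+1.
Proof.
move=> um ac; pose X := lcm_fibre (mlcm q (g u)) m.
have lA s : mlcm (mlcm q (g u)) (lcms s) = mlcm (mlcm q (lcms s)) (g u).
  by apply/mnmP => j; rewrite !mnmE; lia.
pose Y := X :\: lcm_fibre q m.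
have eX : lcm_fibre q m = X :\: Y.
  rewrite setDDr setDv set0U; apply/esym/setIidPr/subsetP => s; rewrite !inE lA => /eqP ->.
  by apply/eqP/lem_anti; rewrite ?lem_mlcml // lem_mlcm lepm_refl.
have dY : down_closed X Y.
  move=> s t /setDP[sX sm] tX ts; rewrite inE tX andbT; apply: contra sm.
  rewrite !inE => /eqP tm; apply/eqP/lem_anti; last by rewrite -tm mlcmS // lcmsS.
  by move: sX; rewrite inE lA => /eqP <-; apply: lem_mlcml.
rewrite eX; apply: (acyclic_quot _ (subsetDl _ _) dY); first exact: convex_lcm_fibre.
  apply: (@acyclic_toggle _ _ _ u) => s; rewrite !inE lcmsU1; congr (_ == _).
  by apply/mnmP => j; rewrite !mnmE; lia.
apply: (@acyclic_fibres _ _ _ (fun s => mlcm q (lcms s)) (@mdeg n)).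
- by apply: (convexS _ (subsetDl _ _) dY); apply: convex_lcm_fibre.
- by move=> s t _ _; apply: lcm_fibre_mono.
move=> s /setDP[]; rewrite !inE lA => /eqP sm nm.
have -> : [set t in Y | mlcm q (lcms t) == mlcm q (lcms s)] = lcm_fibre q (mlcm q (lcms s)).
  apply/setP => t; rewrite /Y !inE lA; case: (mlcm q (lcms t) =P mlcm q (lcms s)) => [->|_]; last by rewrite andbF.
  by rewrite sm eqxx nm.
by apply: ac => //; apply: lem_mlcml.
Qed.

(** The strand of the colon ideal is the disjoint union of the strands of S/I in the multidegrees m'
    with lcm(q, m') = m, and it is filtered by these. *)
Lemma lcm_fibre_colon q m i :
  (forall m', mlcm q m' = m -> acyc 0%MM m' i) -> acyc q m i.
Proof.
move=> ac; apply: (@acyclic_fibres _ _ _ (fun s => mlcm 0%MM (lcms s)) (@mdeg n)).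
- exact: convex_lcm_fibre.
- by move=> s t _ _; apply: lcm_fibre_mono.
move=> s; rewrite inE => /eqP sm.
have -> : [set t in lcm_fibre q m | mlcm 0%MM (lcms t) == mlcm 0%MM (lcms s)] =
    lcm_fibre 0%MM (lcms s).
  apply/setP => t; rewrite ?/Y !inE !mlc0m; case: (lcms t =P lcms s) => [->|_]; last by rewrite andbF.
  by rewrite sm eqxx.
exact: ac.
Qed.

(** The strand of [m] for S/I is a quotient of the colon strand. The subcomplex is filtered by the
    strands of the other m' with lcm(q, m') = m, which enter one homological degree lower through
    the connecting map. *)
Lemma lcm_fibre_grow q m i : (q <= m)%MM ->
  (forall m', m' != m -> mlcm q m' = m -> acyc 0%MM m' i) ->
  acyc q m i.+1 -> acyc 0%MM m i.+1.
Proof.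
move=> qm ac aX; pose Y := lcm_fibre q m :\: lcm_fibre 0%MM m.
have eX : lcm_fibre 0%MM m = lcm_fibre q m :\: Y.
  rewrite setDDr setDv set0U; apply/esym/setIidPr/subsetP => s; rewrite !inE mlc0m => /eqP ->.
  by apply/eqP/lem_anti; rewrite ?lem_mlcmr // lem_mlcm lepm_refl qm.
have dY : down_closed (lcm_fibre q m) Y.
  move=> s t /setDP[sX sm] tX ts; rewrite inE tX andbT; apply: contra sm.
  rewrite !inE !mlc0m => /eqP tm; apply/eqP/lem_anti; last by rewrite -tm lcmsS.
  by move: sX; rewrite inE => /eqP <-; apply: lem_mlcmr.
rewrite eX; apply: (acyclic_quot _ (subsetDl _ _) dY aX); first exact: convex_lcm_fibre.
apply: (@acyclic_fibres _ _ _ (fun s => mlcm 0%MM (lcms s)) (@mdeg n)).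
- by apply: (convexS _ (subsetDl _ _) dY); apply: convex_lcm_fibre.
- by move=> s t _ _; apply: lcm_fibre_mono.
move=> s /setDP[]; rewrite !inE mlc0m => /eqP sm nm.
have -> : [set t in Y | mlcm 0%MM (lcms t) == lcms s] = lcm_fibre 0%MM (lcms s).
  apply/setP => t; rewrite ?/Y !inE !mlc0m; case: (lcms t =P lcms s) => [->|_]; last by rewrite andbF.
  by rewrite sm eqxx nm.
exact: ac.
Qed.

Lemma lcm_fibre_peelN q m u i : (g u <= m)%MM -> ~ acyc q m i.+1 ->
  exists m', [/\ (q <= m')%MM, m' != m, mlcm m' (g u) = m & ~ acyc q m' i].
Proof.
move=> um nac; apply: NNPP => h; apply: nac; apply: (lcm_fibre_peel um) => m' qm' m'm e.
by apply: NNPP => nac; apply: h; exists m'.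
Qed.

Lemma lcm_fibre_colonN q m i : ~ acyc q m i ->
  exists2 m', mlcm q m' = m & ~ acyc 0%MM m' i.
Proof.
move=> nac; apply: NNPP => h; apply: nac; apply: lcm_fibre_colon => m' e.
by apply: NNPP => nac; apply: h; exists m'.
Qed.

(** Since deg lcm(q, m') <= deg q + deg m', the degree hypothesis rules out homology in the strands
    that separate the two complexes. *)
Lemma lcm_fibre_growN q m i : (q <= m)%MM ->
  (forall m', ~ acyc 0%MM m' i -> (mdeg m' + mdeg q < mdeg m)%N) ->
  ~ acyc 0%MM m i.+1 -> ~ acyc q m i.+1.
Proof.
move=> qm hdeg nac ac; apply: nac; apply: (lcm_fibre_grow qm) ac => m' _ e.
apply: NNPP => /hdeg; rewrite -e.
by have := mdeg_lcm_gcd q m'; lia.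
Qed.

(** * Tight multidegrees and complete intersections *)

Lemma tight_generators_coprime d m i u z :
    (forall x y, (g x <= g y)%MM -> x = y) -> (forall x, (mdeg (g x) <= d)%N) ->
    ~ acyc 0%MM m i.+2 ->
    (forall m', ~ acyc 0%MM m' i.+1 -> (mdeg m' + d <= mdeg m)%N) ->
    (forall m', ~ acyc 0%MM m' i -> (mdeg m' + d + d <= mdeg m)%N) ->
  (g u <= m)%MM -> (g z <= m)%MM -> u != z -> mgcd (g u) (g z) = 0%MM.
Proof.
move=> anti gd nac h1 h2 um zm uz; set q := mgcd _ _.
have qu : (q <= g u)%MM := lem_mgcdl _ _.
have qz : (q <= g z)%MM := lem_mgcdr _ _.
have qm := lepm_trans qu um.
(* If q had degree d it would equal [g u], and one minimal generator would divide another. *)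
have qd : (mdeg q < d)%N.
  rewrite (leq_trans _ (gd u)) // ltn_neqAle lem_mdeg // andbT.
  apply: contraNneq uz => e; apply/eqP/anti.
  by rewrite -(lem_mdeg_eq qu e).
have nq : ~ acyc q m i.+2.
  by apply: lcm_fibre_growN => // m' /h1; lia.
have [m1 [qm1 _ e1 /[dup] nq1 /lcm_fibre_colonN[m1' e1' /h1 d1]]] := lcm_fibre_peelN um nq.
(* Where the exponent of [m1] is below that of [m], the latter is the exponent of [g u]. There [g z]
   has the same exponent as q, and q divides [m1]. *)
have zm1 : (g z <= m1)%MM.
  apply/mnm_lepP => j; have := lem_coef j zm; have := lem_coef j qm1.
  by rewrite -e1 !mnmE; lia.
have [m2 [qm2 _ e2 /lcm_fibre_colonN[m2' e2' /h2 d2]]] := lcm_fibre_peelN zm1 nq1.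
(* Each peeling lowers the degree by at most d - deg q, because q divides both the generator and the
   remaining multidegree. Passing from the colon ideal back to I costs at most deg q. Hence deg m <=
   deg m2' + 2d - deg q, and [h2] forces deg q = 0. *)
apply/eqP; rewrite -mdeg_eq0.
have := mdeg_lcm_gcd m1 (g u); have := mdeg_lcm_gcd m2 (g z).
have := mdeg_lcm_gcd q m2'; rewrite e1 e2 e2'.
have : (mdeg q <= mdeg (mgcd m1 (g u)))%N by apply: lem_mdeg; rewrite lem_mgcd qm1.
have : (mdeg q <= mdeg (mgcd m2 (g z)))%N by apply: lem_mdeg; rewrite lem_mgcd qm2.
by have := gd u; have := gd z; lia.
Qed.

Lemma coprime_fibre (m : 'X_{1..n}) s :
    (forall x, (g x <= m)%MM -> g x != 0%MM) ->
    (forall x y, (g x <= m)%MM -> (g y <= m)%MM -> x != y -> mgcd (g x) (g y) = 0%MM) ->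
    (lcms s <= m)%MM ->
  lcm_fibre 0%MM (lcms s) = [set s].
Proof.
move=> gn0 cop sm.
(* A variable of [g x] divides no other generator below [m], so the lcm reveals whether [x] belongs
   to the set. *)
have key t r : (lcms r <= m)%MM -> lcms t = lcms r -> t \subset r.
  move=> rm e; apply/subsetP => x xt; apply/negPn/negP => xr.
  have xm : (g x <= m)%MM by apply: lepm_trans rm; rewrite -e lcms_ge.
  case/negP: (gn0 x xm); apply/eqP/mnmP => j; rewrite mnmE; apply/eqP; rewrite -leqn0.
  case: (posnP (g x j)) => [->//|xj].
  apply: leq_trans (lem_coef j (lcms_ge xt)) _; rewrite e mnmE.
  apply/bigmax_leqP => y yr; have ym := lepm_trans (lcms_ge yr) rm.
  have xy : x != y by apply: contraNneq xr => ->.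
  by have /mnmP/(_ j) := cop x y xm ym xy; rewrite !mnmE; lia.
apply/setP => t; rewrite !inE mlc0m; apply/eqP/eqP => [e|->//].
by apply/eqP; rewrite eqEsubset !key // e.
Qed.

(** The indicator of [s] is a cycle, and no larger set is available to bound it. *)
Lemma not_acyclic_point s : ~ @acyclic K N [set s] #|s|.
Proof.
case/(_ (fun t => (t == s)%:R)) => [t|t|w hw /(_ s (set11 s))].
- by rewrite inE; case: (t =P s) => [->|_]; rewrite eqxx.
- rewrite inE => /eqP ->; rewrite /bd big1 // => x xs.
  case: eqP => [e|_]; last by rewrite mulr0.
  by case/negP: xs; rewrite -e setU11.
rewrite eqxx /bd big1 => [/esym/eqP|x xs]; first by rewrite oner_eq0.
have [->|/hw/andP[]] := eqVneq (w (x |: s)) 0; first by rewrite mulr0.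
by rewrite inE => /eqP e _; rewrite -e setU11 in xs.
Qed.

Lemma chain_of_not_acyclic X i : ~ @acyclic K N X i -> exists2 s, s \in X & #|s| = i.
Proof.
move=> nac; apply: NNPP => h; apply: nac => c hc _.
have c0 s : c s = 0.
  by apply/eqP/negPn/negP => /hc/andP[sX /eqP si]; apply: h; exists s.
exists (fun _ => 0) => [s|s _]; first by rewrite eqxx.
by rewrite c0 /bd big1 // => x _; rewrite mulr0.
Qed.

(** Each variable occurs in at most one of the generators, so in every exponent the maximum equals
    the sum. *)
Lemma mdeg_lcms_coprime (m : 'X_{1..n}) s :
    (forall x y, (g x <= m)%MM -> (g y <= m)%MM -> x != y -> mgcd (g x) (g y) = 0%MM) ->
    (lcms s <= m)%MM ->
  (mdeg (lcms s) = \sum_(x in s) mdeg (g x))%N.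
Proof.
move=> cop sm; rewrite mdegE.
under [RHS]eq_bigr => x _ do rewrite mdegE.
rewrite [RHS]exchange_big; apply: eq_bigr => j _; rewrite mnmE.
have [[x /andP[xs xj]]|h0] := classic (exists x, (x \in s) && (g x j != 0)%N); last first.
  have h x : x \in s -> g x j = 0%N.
    by move=> xs; apply/eqP/negPn/negP => xj; apply: h0; exists x; rewrite xs.
  by rewrite (eq_bigr (fun _ => 0%N)) // (eq_bigr (fun _ => 0%N) h) big1 // big1.
have h0 y : (y \in s) && (y != x) -> g y j = 0%N.
  case/andP => ys yx; have sub z : z \in s -> (g z <= m)%MM.
    by move=> zs; apply: lepm_trans sm; apply: lcms_ge.
  by have /mnmP/(_ j) := cop y x (sub y ys) (sub x xs) yx; rewrite !mnmE; lia.
rewrite (bigD1 x) //= [RHS](bigD1 x) //= (eq_bigr (fun _ => 0%N) h0).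
by rewrite [in RHS](eq_bigr (fun _ => 0%N) h0) !big1_eq maxn0 addn0.
Qed.

(** Some set of i + 2 generators has lcm [m], and tightness makes these pairwise coprime. Any [a] of
    them have a one-point strand, as in a Koszul complex, and their lcm has degree at least a e. *)
Lemma tight_lower_bound d e a m i :
    (forall x y, (g x <= g y)%MM -> x = y) ->
    (forall x, (e <= mdeg (g x) <= d)%N) -> (0 < e)%N ->
    ~ acyc 0%MM m i.+2 ->
    (forall m', ~ acyc 0%MM m' i.+1 -> (mdeg m' + d <= mdeg m)%N) ->
    (forall m', ~ acyc 0%MM m' i -> (mdeg m' + d + d <= mdeg m)%N) ->
  (a <= i.+2)%N -> exists2 m', ~ acyc 0%MM m' a & (a * e <= mdeg m')%N.
Proof.
move=> anti gd e0 nac h1 h2 ai.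
have cop x y : (g x <= m)%MM -> (g y <= m)%MM -> x != y -> mgcd (g x) (g y) = 0%MM.
  by move=> xm ym; apply: (tight_generators_coprime anti _ nac h1 h2) => // z; case/andP: (gd z).
have gn0 x : (g x <= m)%MM -> g x != 0%MM.
  by move=> _; rewrite -mdeg_eq0 -lt0n; case/andP: (gd x) => + _; apply: leq_trans.
have [s] := chain_of_not_acyclic nac; rewrite inE mlc0m => /eqP sm cs.
have [t ts ta] : exists2 t : {set 'I_N}, t \subset s & #|t| = a.
  have : (a <= #|s|)%N by rewrite cs.
  elim: {ai} a => [|k IH] ks; first by exists set0; rewrite ?sub0set ?cards0.
  have [t ts tk] := IH (ltnW ks).
  have /set0Pn[x /setDP[xs xt]] : s :\: t != set0.
    by rewrite -card_gt0 cardsD (setIidPr ts) tk subn_gt0.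
  by exists (x |: t); rewrite ?subUset ?sub1set ?xs // cardsU1 xt tk.
have tm : (lcms t <= m)%MM by rewrite -sm lcmsS.
exists (lcms t).
  by rewrite (coprime_fibre gn0 cop tm) -ta; apply: not_acyclic_point.
rewrite (mdeg_lcms_coprime cop tm) -ta -sum_nat_const; apply: leq_sum => x _.
by case/andP: (gd x).
Qed.
End LcmComplex.

(** * Comparison of graded free resolutions *)

Section PolynomialOfCoefficients.
Variables (K : comNzRingType) (n : nat).

Definition mpoly_of (k : nat) (E : 'X_{1..n} -> K) : {mpoly K[n]} :=
  \sum_(m : 'X_{1..n < k}) E m *: 'X_[m].

Lemma mcoeff_mpoly_of k E m : (mpoly_of k E)@_m = if (mdeg m < k)%N then E m else 0.
Proof.
case: ifP => [|mk]; first exact: mcoeff_mpoly.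
rewrite raddf_sum big1 // => m' _ /=; rewrite mcoeffZ mcoeffX.
by case: eqP mk => [<-|_]; rewrite ?bmdeg ?mulr0.
Qed.

Lemma mcoeff_big_mdeg (p : {mpoly K[n]}) m : (msize p <= mdeg m)%N -> p@_m = 0.
Proof.
move=> h; apply/eqP; rewrite mcoeff_eq0; apply: contraTN h => h.
by rewrite -ltnNge; apply: msize_mdeg_lt.
Qed.

(* The part of degree [a] of [p *: e], where [e] is a generator of degree [b]. *)
Definition hpart (a b : nat) (p : {mpoly K[n]}) : {mpoly K[n]} :=
  mpoly_of (msize p) (fun m => if (b + mdeg m == a)%N then p@_m else 0).

Lemma mcoeff_hpart a b p m :
  (hpart a b p)@_m = if (b + mdeg m == a)%N then p@_m else 0.
Proof.
rewrite mcoeff_mpoly_of; case: ltnP => // /mcoeff_big_mdeg ->; by rewrite if_same.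
Qed.

Definition homog_entry (a b : nat) (p : {mpoly K[n]}) :=
  forall m, m \in msupp p -> (b + mdeg m)%N = a.

Lemma homog_entryP a b p : homog_entry a b p <-> hpart a b p = p.
Proof.
split=> [h|<- m]; last by rewrite mcoeff_msupp mcoeff_hpart; case: (_ =P a); rewrite ?eqxx.
apply/mpolyP => m; rewrite mcoeff_hpart; case: eqP => // /eqP ne.
by apply/esym/eqP; rewrite mcoeff_eq0; apply: contra ne => /h ->.
Qed.

Lemma hpart_homog a b p : homog_entry a b (hpart a b p).
Proof. by move=> m; rewrite mcoeff_msupp mcoeff_hpart; case: (_ =P a); rewrite ?eqxx. Qed.

Lemma hpart_is_additive a b : additive (hpart a b).
Proof.
move=> p q; apply/mpolyP => m; rewrite mcoeffB !mcoeff_hpart mcoeffB.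
by case: ifP; rewrite ?subr0.
Qed.

HB.instance Definition _ a b :=
  GRing.isAdditive.Build {mpoly K[n]} {mpoly K[n]} (hpart a b) (hpart_is_additive a b).

Lemma hpartM a b d p q : homog_entry b d q -> hpart a d (p * q) = hpart a b p * q.
Proof.
move=> hq; apply/mpolyP => m; rewrite mcoeff_hpart !mcoeffM.
rewrite [RHS](eq_bigr (fun k : 'X_{1..n < (mdeg m).+1, (mdeg m).+1} =>
  if (d + mdeg m == a)%N then p@_k.1 * q@_k.2 else 0)).
  by case: ifP => _; rewrite ?big1_eq.
move=> k /eqP mk; rewrite mcoeff_hpart.
have [->|/[!mcoeff_eq0]/negPn/hq kq] := eqVneq (q@_k.2) 0; first by rewrite !mulr0 if_same.
have -> : (d + mdeg m = b + mdeg k.1)%N by have := congr1 (@mdeg n) mk; rewrite mdegD -kq; lia.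
by case: ifP; rewrite ?mul0r.
Qed.

Lemma homog_entryB a b p q : homog_entry a b p -> homog_entry a b q ->
  homog_entry a b (p - q).
Proof. by move=> /homog_entryP hp /homog_entryP hq; apply/homog_entryP; rewrite raddfB /= hp hq. Qed.

Lemma homog_entryM a b d p q : homog_entry a b p -> homog_entry b d q ->
  homog_entry a d (p * q).
Proof.
by move=> /homog_entryP hp hq; apply/homog_entryP; rewrite (hpartM _ _ hq) hp.
Qed.

Definition homog_mx r r' (sr : 'I_r -> nat) (sc : 'I_r' -> nat) (A : 'M[{mpoly K[n]}]_(r, r')) :=
  forall k l, homog_entry (sr k) (sc l) (A k l).

Lemma homog_mxM r1 r2 r3 (s1 : 'I_r1 -> nat) (s2 : 'I_r2 -> nat) (s3 : 'I_r3 -> nat) A B :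
  homog_mx s1 s2 A -> homog_mx s2 s3 B -> homog_mx s1 s3 (A *m B).
Proof.
move=> hA hB k l; apply/homog_entryP; rewrite mxE raddf_sum; apply: eq_bigr => j _ /=.
by apply/homog_entryP/(homog_entryM (hA k j) (hB j l)).
Qed.

Lemma homog_mxB r r' (sr : 'I_r -> nat) (sc : 'I_r' -> nat) A B :
  homog_mx sr sc A -> homog_mx sr sc B -> homog_mx sr sc (A - B).
Proof. by move=> hA hB k l; rewrite !mxE; apply: homog_entryB. Qed.

Lemma homog_mx1 r (s : 'I_r -> nat) : homog_mx s s 1%:M.
Proof.
move=> k l m; rewrite mxE; case: eqP => [<-|_]; last by rewrite msupp0.
by rewrite msupp1 inE => /eqP ->; rewrite mdeg0 addn0.
Qed.

(** The given solutions [w] of the rows may be inhomogeneous. As [B] and [D] are homogeneous, taking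
    the graded part of each entry preserves the equation. *)
Lemma homog_mx_factor r1 r2 r3 (s1 : 'I_r1 -> nat) (s2 : 'I_r2 -> nat) (s3 : 'I_r3 -> nat)
    B (D : 'M_(r2, r3)) :
    homog_mx s1 s3 B -> homog_mx s2 s3 D -> (forall k, exists w, row k B = w *m D) ->
  exists2 A, homog_mx s1 s2 A & B = A *m D.
Proof.
move=> hB hD /fin_all_exists[w wE]; exists (\matrix_(k, l) hpart (s1 k) (s2 l) (w k 0 l)).
  by move=> k l; rewrite mxE; apply: hpart_homog.
apply/matrixP => k j; have /homog_entryP <- := hB k j.
have := congr1 (fun v : 'rV_r3 => v 0 j) (wE k); rewrite !mxE => ->.
by rewrite raddf_sum; apply: eq_bigr => l _ /=; rewrite mxE (hpartM _ _ (hD l j)).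
Qed.

End PolynomialOfCoefficients.

Section Comparison.
Variables (K : fieldType) (n : nat) (I : idealr {mpoly K[n]}).
Local Notation S := {mpoly K[n]}.
Local Notation resolution := (graded_free_resolution (@quot_piece K n I)).
Hypothesis homI : forall j (p : S), p \in I -> hpart j 0 p \in I.
Implicit Types F : resolution.

Lemma diff_homog F i : homog_mx (@gf_shift _ _ _ _ F i.+1) (@gf_shift _ _ _ _ F i) (gf_diff F i).
Proof. by move=> k l m; apply: gf_diff_homog. Qed.

Lemma diff_diff F i : gf_diff F i.+1 *m gf_diff F i = 0.
Proof.
apply/row_matrixP => k; rewrite row_mul row0; apply/gf_exact.
by exists (delta_mx 0 k); rewrite -rowE.
Qed.

Lemma quot_class_eq (f h : S) : quot_class I f = quot_class I h <-> f - h \in I.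
Proof. by split=> [/eqP|fI]; [|apply/eqP]; rewrite -Quotient.idealrBE. Qed.

Lemma quot_class0 : quot_class I 0 = 0.
Proof. exact: (rmorph0 (\pi_({ideal_quot I})%qT)). Qed.

Lemma quot_class_eq0 (f : S) : quot_class I f = 0 <-> f \in I.
Proof. by rewrite -quot_class0 quot_class_eq subr0. Qed.

Lemma quot_classD f h : quot_class I (f + h) = quot_class I f + quot_class I h.
Proof. exact: (rmorphD (\pi_({ideal_quot I})%qT)). Qed.

Lemma quot_classZ f h : f *: quot_class I h = quot_class I (f * h).
Proof. by apply/esym; exact: (rmorphM (\pi_({ideal_quot I})%qT)). Qed.

Lemma quot_class_sum r (v f : 'I_r -> S) :
  \sum_k v k *: quot_class I (f k) = quot_class I (\sum_k v k * f k).
Proof.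
by rewrite (big_morph _ quot_classD quot_class0); apply: eq_bigr => k _; rewrite quot_classZ.
Qed.

Lemma homog_lift_gen F j x : quot_piece j x ->
  exists2 v : 'rV[S]_(gf_rank F 0), forall l, homog_entry j (gf_shift l) (v 0 l)
    & \sum_l v 0 l *: gf_gen l = x.
Proof.
case=> f hf ->; have [v vE] := gf_aug_surj F (quot_class I f).
have /fin_all_exists2[h hh hE] := @gf_gen_homog _ _ _ _ F.
have h0 k (p : S) : p \is k.-homog -> homog_entry k 0 p.
  by move=> /dhomogP hp m /hp; rewrite add0n.
exists (\row_l hpart j (gf_shift l) (v 0 l)) => [l|].
  by rewrite mxE; apply: hpart_homog.
rewrite (eq_bigr (fun l => hpart j (gf_shift l) (v 0 l) *: quot_class I (h l))); last first.
  by move=> l _; rewrite mxE hE.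
rewrite quot_class_sum (eq_bigr (fun l => hpart j 0 (v 0 l * h l))); last first.
  by move=> l _; rewrite (hpartM _ _ (h0 _ _ (hh l))).
rewrite -raddf_sum; have <- : hpart j 0 f = f by apply/homog_entryP/h0.
(* The lift by graded parts differs from [f] by the degree j part of an element of I, which lies in
   I by homogeneity. *)
apply/quot_class_eq; rewrite -raddfB; apply/homI/quot_class_eq.
by rewrite -quot_class_sum -vE; apply: eq_bigr => l _; rewrite hE.
Qed.

Lemma homog_lift_gens F r (s : 'I_r -> nat) (x : 'I_r -> quot_module I) :
    (forall k, quot_piece (s k) (x k)) ->
  exists2 A, homog_mx s (@gf_shift _ _ _ _ F 0) A
    & forall k, \sum_l A k l *: gf_gen l = x k.
Proof.
move=> hx; have h k := @homog_lift_gen F (s k) (x k) (hx k).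
have /fin_all_exists2[v vh vE] := h.
exists (\matrix_(k, l) v k 0 l) => [k l|k]; first by rewrite mxE.
by rewrite -vE; apply: eq_bigr => l _; rewrite mxE.
Qed.

Lemma homog_lift0 F r (s : 'I_r -> nat) (B : 'M_(r, gf_rank F 0)) :
    homog_mx s (@gf_shift _ _ _ _ F 0) B -> (forall k, \sum_l B k l *: gf_gen l = 0) ->
  exists2 A, homog_mx s (@gf_shift _ _ _ _ F 1) A & B = A *m gf_diff F 0.
Proof.
move=> hB B0; apply: (homog_mx_factor hB (@diff_homog F 0)) => k.
by apply/gf_exact0; rewrite -[RHS](B0 k); apply: eq_bigr => l _; rewrite mxE.
Qed.

Lemma homog_lift F i r (s : 'I_r -> nat) (B : 'M_(r, gf_rank F i.+1)) :
    homog_mx s (@gf_shift _ _ _ _ F i.+1) B -> B *m gf_diff F i = 0 ->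
  exists2 A, homog_mx s (@gf_shift _ _ _ _ F i.+2) A & B = A *m gf_diff F i.+1.
Proof.
move=> hB B0; apply: (homog_mx_factor hB (@diff_homog F i.+1)) => k.
by apply/gf_exact; rewrite -row_mul B0 row0.
Qed.

(* [A] is the degree [i] component of a graded chain map that lifts [c] times the
   identity of S/I. *)
Fixpoint lifts F F' (c : S) i : 'M[S]_(gf_rank F i, gf_rank F' i) -> Prop :=
  match i with
  | 0 => fun A => homog_mx (@gf_shift _ _ _ _ F 0) (@gf_shift _ _ _ _ F' 0) A /\
           forall k, \sum_l A k l *: gf_gen l = c *: gf_gen k
  | j.+1 => fun A => homog_mx (@gf_shift _ _ _ _ F j.+1) (@gf_shift _ _ _ _ F' j.+1) A /\
           exists2 B, lifts c B & A *m gf_diff F' j = gf_diff F j *m B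
  end.

Lemma lifts_homog F F' c i (A : 'M_(gf_rank F i, gf_rank F' i)) :
  lifts c A -> homog_mx (@gf_shift _ _ _ _ F i) (@gf_shift _ _ _ _ F' i) A.
Proof. by case: i A => [|i] A []. Qed.

Lemma lifts_extend F F' i (B : 'M_(gf_rank F i, gf_rank F' i)) : lifts 1 B ->
  exists2 A : 'M_(gf_rank F i.+1, gf_rank F' i.+1), lifts 1 A
    & A *m gf_diff F' i = gf_diff F i *m B.
Proof.
move=> lB; have hB := homog_mxM (@diff_homog F i) (lifts_homog lB).
suff [A hA e] : exists2 A, homog_mx (@gf_shift _ _ _ _ F i.+1) (@gf_shift _ _ _ _ F' i.+1) A
    & gf_diff F i *m B = A *m gf_diff F' i.
  by exists A => //=; split => //; exists B.
case: i B lB hB => [|i] B [_ lB] hB.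
  apply: (homog_lift0 hB) => k.
  transitivity (\sum_j gf_diff F 0 k j *: gf_gen j).
    under eq_bigr => l _ do rewrite mxE scaler_suml.
    rewrite exchange_big; apply: eq_bigr => j _.
    have := lB j; rewrite scale1r => <-; rewrite scaler_sumr.
    by apply: eq_bigr => l _; rewrite scalerA.
  have /gf_exact0 : exists w, row k (gf_diff F 0) = w *m gf_diff F 0.
    by exists (delta_mx 0 k); rewrite -rowE.
  by move=> e; rewrite -[RHS]e; apply: eq_bigr => l _; rewrite mxE.
apply: (homog_lift hB); case: lB => C _ e.
by rewrite -mulmxA e mulmxA diff_diff mul0mx.
Qed.

Lemma lifts_exists F F' i : exists A : 'M_(gf_rank F i, gf_rank F' i), lifts 1 A.
Proof.
elim: i => [|i [B /lifts_extend[A]]]; last by exists A.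
have [A hA AE] := homog_lift_gens F' (@gf_gen_homog _ _ _ _ F).
by exists A; split => // k; rewrite scale1r AE.
Qed.

Lemma liftsM F F' F'' a b i (A : 'M_(gf_rank F i, gf_rank F' i))
    (B : 'M_(gf_rank F' i, gf_rank F'' i)) :
  lifts a A -> lifts b B -> lifts (a * b) (A *m B).
Proof.
elim: i A B => [|i IH] A B [hA lA] [hB lB]; split; try exact: homog_mxM hA hB.
  move=> k; under eq_bigr => l _ do rewrite mxE scaler_suml.
  rewrite exchange_big mulrC -scalerA -lA scaler_sumr; apply: eq_bigr => j _.
  rewrite scalerA mulrC -scalerA -lB scaler_sumr.
  by apply: eq_bigr => l _; rewrite scalerA.
have [[A' lA' eA] [B' lB' eB]] := (lA, lB).
exists (A' *m B'); first exact: IH.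
by rewrite -mulmxA eB mulmxA eA mulmxA.
Qed.

Lemma liftsB F F' a b i (A B : 'M_(gf_rank F i, gf_rank F' i)) :
  lifts a A -> lifts b B -> lifts (a - b) (A - B).
Proof.
elim: i A B => [|i IH] A B [hA lA] [hB lB]; split; try exact: homog_mxB.
  move=> k; rewrite scalerBl -lA -lB -sumrB; apply: eq_bigr => l _.
  by rewrite !mxE scalerBl.
have [[A' lA' eA] [B' lB' eB]] := (lA, lB).
exists (A' - B'); first exact: IH.
by rewrite mulmxBl mulmxBr eA eB.
Qed.

Lemma lifts1 F i : lifts 1 (1%:M : 'M_(gf_rank F i, gf_rank F i)).
Proof.
elim: i => [|i IH]; split; try exact: homog_mx1.
  move=> k; rewrite (bigD1 k) //= big1 => [|l lk]; first by rewrite mxE eqxx addr0.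
  by rewrite mxE eq_sym (negPf lk) scale0r.
by exists 1%:M; rewrite // mulmx1 mul1mx.
Qed.

(** Only the two homotopy terms in degree [i] are recorded. The component [t] is unconstrained
    because, after tensoring with K, its term vanishes on cycles. *)
Fixpoint null_homotopic F F' i : 'M[S]_(gf_rank F i, gf_rank F' i) -> Prop :=
  match i with
  | 0 => fun A => exists2 s, homog_mx (@gf_shift _ _ _ _ F 0) (@gf_shift _ _ _ _ F' 1) s
           & A = s *m gf_diff F' 0
  | j.+1 => fun A => exists s t,
      homog_mx (@gf_shift _ _ _ _ F j.+1) (@gf_shift _ _ _ _ F' j.+2) s
        /\ A = s *m gf_diff F' j.+1 + gf_diff F j *m t
  end.

Lemma lifts0_null_homotopic F F' i (A : 'M_(gf_rank F i, gf_rank F' i)) :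
  lifts 0 A -> null_homotopic A.
Proof.
elim: i A => [|i IH] A [hA lA].
  by apply: (homog_lift0 hA) => k; rewrite lA scale0r.
case: lA => B lB eA; have {}IH := IH B lB.
(* Composing the homotopy of [B] with the differential of [F] kills its other term, as two
   successive differentials compose to zero. *)
suff [s hs es] : exists2 t, homog_mx (@gf_shift _ _ _ _ F i) (@gf_shift _ _ _ _ F' i.+1) t
    & gf_diff F i *m B = gf_diff F i *m t *m gf_diff F' i.
  have [|r hr er] := homog_lift (homog_mxB hA (homog_mxM (@diff_homog F i) hs)).
    by rewrite mulmxBl eA es subrr.
  by exists r, s; split=> //; rewrite -er subrK.
case: i B IH {A hA lB eA} => [|i] B /=.
  by case=> s hs ->; exists s; rewrite // mulmxA.
by case=> s [t [hs ->]]; exists s; rewrite // mulmxDr !mulmxA diff_diff mul0mx addr0.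
Qed.

(** * Independence of Betti numbers from the resolution *)

Definition tcycle F i : 'rV[K]_(gf_rank F i) -> Prop :=
  match i with 0 => fun _ => True | j.+1 => fun z => z *m tensor_diff F j = 0 end.

Definition in_degree r (s : 'I_r -> nat) j (z : 'rV[K]_r) :=
  forall k, z 0 k != 0 -> s k = j.

Lemma in_degreeB r (s : 'I_r -> nat) j z w :
  in_degree s j z -> in_degree s j w -> in_degree s j (z - w).
Proof.
move=> hz hw k; rewrite !mxE; have [->|/hz//] := eqVneq (z 0 k) 0.
by rewrite add0r oppr_eq0 => /hw.
Qed.

Lemma in_degree_mul r r' (s : 'I_r -> nat) (s' : 'I_r' -> nat) j z (A : 'M[S]_(r, r')) :
    homog_mx s s' A -> in_degree s j z ->
  in_degree s' j (z *m map_mx (mcoeff 0%MM) A).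
Proof.
move=> hA hz k nz; have [l zl Al] : exists2 l, z 0 l != 0 & (A l k)@_0%MM != 0.
  suff /existsP[l /andP[]] : [exists l, (z 0 l != 0) && ((A l k)@_0%MM != 0)] by exists l.
  apply: contraNT nz => /existsPn h; apply/eqP.
  rewrite mxE big1 // => l _; rewrite mxE.
  have := h l; rewrite negb_and !negbK => /orP[/eqP->|/eqP->]; first by rewrite mul0r.
  by rewrite mulr0.
have := hA l k 0%MM; rewrite mcoeff_msupp mdeg0 addn0 => -> //.
exact: hz.
Qed.

Lemma in_degreeP F i j (z : 'rV[K]_(gf_rank F i)) :
  reflect (in_degree (@gf_shift _ _ _ _ F i) j z) (z <= tensor_piece F i j)%MS.
Proof.
apply: (iffP submxP) => [[w ->] k|hz].
  by rewrite mul_mx_diag !mxE; case: (gf_shift k =P j) => // _; rewrite mulr0 eqxx.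
exists z; apply/rowP => k; rewrite mul_mx_diag !mxE.
have [->|/hz->] := eqVneq (z 0 k) 0; first by rewrite mul0r.
by rewrite eqxx mulr1.
Qed.

Lemma tensor_cyclesP F i j (z : 'rV[K]_(gf_rank F i)) :
  (z <= tensor_cycles F i j)%MS <-> in_degree (@gf_shift _ _ _ _ F i) j z /\ tcycle z.
Proof.
case: i z => [|i] z /=; first by split=> [/in_degreeP|[/in_degreeP]].
rewrite sub_capmx; split=> [/andP[/in_degreeP h /sub_kermxP]|[/in_degreeP -> /sub_kermxP]] //.
Qed.

Lemma tensor_boundariesP F i j (z : 'rV[K]_(gf_rank F i)) :
  (z <= tensor_boundaries F i j)%MS <->
  exists2 w, in_degree (@gf_shift _ _ _ _ F i.+1) j w & z = w *m tensor_diff F i.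
Proof.
split=> [/submxP[w ->]|[w /in_degreeP/submxP[v ->] ->]].
  exists (w *m tensor_piece F i.+1 j); last by rewrite mulmxA.
  by apply/in_degreeP/submxMl.
by rewrite -mulmxA submxMl.
Qed.

Lemma boundaries_sub_cycles F i j : (tensor_boundaries F i j <= tensor_cycles F i j)%MS.
Proof.
apply/rV_subP => z /tensor_boundariesP[w hw ->]; apply/tensor_cyclesP; split.
  exact: in_degree_mul (@diff_homog F i) hw.
by case: i {z} w {hw} => //= i w; rewrite -mulmxA -map_mxM diff_diff map_mx0 mulmx0.
Qed.

Lemma betti_eq0 F i j : betti F i j = 0%N <->
  forall z : 'rV[K]_(gf_rank F i), in_degree (@gf_shift _ _ _ _ F i) j z -> tcycle z ->
  exists2 w, in_degree (@gf_shift _ _ _ _ F i.+1) j w & z = w *m tensor_diff F i.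
Proof.
have sub := mxrank_leqif_sup (boundaries_sub_cycles F i j).
have -> : betti F i j = 0%N <-> (tensor_cycles F i j <= tensor_boundaries F i j)%MS.
  rewrite -(geq_leqif sub) /betti; split=> [/eqP|h]; first by rewrite subn_eq0.
  by apply/eqP; rewrite subn_eq0.
split=> [/rV_subP h z hz cz|h].
  by apply/tensor_boundariesP/h/tensor_cyclesP.
by apply/rV_subP => z /tensor_cyclesP[hz cz]; apply/tensor_boundariesP/h.
Qed.

(** Lifts [A] and [B] of the identity in both directions make A B - 1 null-homotopic, so a cycle z
    differs from z A B by a boundary. The cycle z A bounds in [F'], hence z A B bounds in [F]. *)
Lemma betti_eq0_transfer F F' i j : betti F' i j = 0%N -> betti F i j = 0%N.
Proof.
move=> /betti_eq0 b0; apply/betti_eq0 => z hz cz.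
pose e r r' (A : 'M[S]_(r, r')) := map_mx (mcoeff 0%MM) A.
have [A lA] := lifts_exists F F' i; have [B lB] := lifts_exists F' F i.
have [B' lB' eB] := lifts_extend lB.
have cA : tcycle (z *m e _ _ A).
  case: i z A lA {hz b0 B lB B' lB' eB} cz => //= i z A [_ [A' _ eA]] cz.
  by rewrite -mulmxA -map_mxM eA map_mxM mulmxA cz mul0mx.
have [w hw ew] := b0 _ (in_degree_mul (lifts_homog lA) hz) cA.
have hw' : in_degree (@gf_shift _ _ _ _ F i.+1) j (w *m e _ _ B').
  exact: in_degree_mul (lifts_homog lB') hw.
have ew' : z *m e _ _ A *m e _ _ B = w *m e _ _ B' *m tensor_diff F i.
  by rewrite /e ew -!mulmxA -!map_mxM eB.
have [s hs es] : exists2 s, homog_mx (@gf_shift _ _ _ _ F i) (@gf_shift _ _ _ _ F i.+1) s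
    & z *m e _ _ (A *m B - 1%:M) = z *m e _ _ s *m tensor_diff F i.
  have := liftsB (liftsM lA lB) (lifts1 F i); rewrite mulr1 subrr => /lifts0_null_homotopic.
  clear hz b0 cA w hw ew hw' ew' B' lB' eB.
  case: i z cz A lA B lB => [|i] z cz A lA B lB /=.
    by case=> s hs ->; exists s; rewrite // /e map_mxM mulmxA.
  case=> s [t [hs ->]]; exists s => //.
  by rewrite /e map_mxD !map_mxM mulmxDr !mulmxA [z *m map_mx _ (gf_diff F i)]cz mul0mx addr0.
exists (w *m e _ _ B' - z *m e _ _ s).
  exact: in_degreeB hw' (in_degree_mul hs hz).
rewrite mulmxBl -ew' -es /e map_mxB map_mx1 mulmxBr mulmx1 map_mxM mulmxA.
by rewrite opprB addrC subrK.
Qed.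
End Comparison.

(** * The Taylor resolution *)

Section RowChains.
Variables (K : comNzRingType) (N : nat).

Definition faces i : {set {set 'I_N}} := [set s : {set 'I_N} | #|s| == i].

Definition incidence (s t : {set 'I_N}) : K := \sum_(x | x \notin s) sgn K x s * (t == x |: s)%:R.

Lemma incidence_sub s t : incidence s t != 0 -> s \subset t.
Proof.
apply: contraNT => st; apply/eqP/big1 => x _; case: eqP st => [->|_ _]; last by rewrite mulr0.
by rewrite subsetUr.
Qed.

Lemma bd_incidence (c : {set 'I_N} -> K) s : bd c s = \sum_t incidence s t * c t.
Proof.
under eq_bigr => t _ do rewrite mulr_suml.
rewrite exchange_big; apply: eq_bigr => x _.
rewrite (bigD1 (x |: s)) //= eqxx mulr1 big1 ?addr0 // => t /negPf ->.
by rewrite mulr0 mul0r.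
Qed.

(** At most one index contributes; the sum extends a vector indexed by the [i]-element sets by zero
    to all sets. *)
Definition row_chain (R : nmodType) i (z : 'rV[R]_#|faces i|) (s : {set 'I_N}) : R :=
  \sum_(k | enum_val k == s) z 0 k.

Lemma row_chain_val (R : nmodType) i (z : 'rV[R]_#|faces i|) k : row_chain z (enum_val k) = z 0 k.
Proof.
rewrite /row_chain (bigD1 k) //= big1 ?addr0 // => l /andP[/eqP/enum_val_inj ->].
by rewrite eqxx.
Qed.

Lemma row_chain_card (R : nmodType) i (z : 'rV[R]_#|faces i|) (s : {set 'I_N}) : #|s| != i -> row_chain z s = 0.
Proof.
move=> si; rewrite /row_chain big1 // => k /eqP ks.
by case/negP: si; rewrite -ks; have := enum_valP k; rewrite inE.
Qed.

Lemma facesP i (s : {set 'I_N}) : #|s| = i -> exists k : 'I_#|faces i|, enum_val k = s.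
Proof.
move=> si; have sA : s \in faces i by rewrite inE si.
by exists (enum_rank_in sA s); rewrite enum_rankK_in.
Qed.

Lemma bd_row_chain i (z : 'rV[K]_#|faces i|) s :
  bd (row_chain z) s = \sum_k incidence s (enum_val k) * z 0 k.
Proof.
rewrite bd_incidence; under eq_bigr => t _ do rewrite mulr_sumr.
rewrite (exchange_big_dep predT) //=; apply: eq_bigr => k _.
by rewrite (big_pred1 (enum_val k)) // => t; rewrite /= eq_sym.
Qed.

Lemma row_chain_mk i (c : {set 'I_N} -> K) (s : {set 'I_N}) :
  #|s| = i -> row_chain (\row_(k < #|faces i|) c (enum_val k)) s = c s.
Proof. by case/facesP => k <-; rewrite row_chain_val mxE. Qed.
End RowChains.

Section Taylor.
Variables (K : fieldType) (n N : nat) (g : 'I_N -> 'X_{1..n}).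
Local Notation S := {mpoly K[n]}.

(** The subtraction of exponents truncates, but a nonzero incidence number means inclusion of the
    sets, and then the lcms divide each other. *)
Definition taylor_diff i : 'M[S]_(#|faces N i.+1|, #|faces N i|) :=
  \matrix_(k, l) (incidence K (enum_val l) (enum_val k) *:
                   'X_[lcms g (enum_val k) - lcms g (enum_val l)]).

Definition taylor_shift i (k : 'I_#|faces N i|) := mdeg (lcms g (enum_val k)).

(* The multidegree [m] strand of the vector [v], as a chain. *)
Definition strand i (v : 'rV[S]_#|faces N i|) m (s : {set 'I_N}) : K :=
  if (lcms g s <= m)%MM then (row_chain v s)@_(m - lcms g s) else 0.

Lemma strand_card i (v : 'rV[S]_#|faces N i|) m (s : {set 'I_N}) : #|s| != i -> strand v m s = 0.
Proof. by move=> si; rewrite /strand row_chain_card // mcoeff0 if_same. Qed.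

Lemma eq_strand i (v w : 'rV[S]_#|faces N i|) :
  (forall m s, strand v m s = strand w m s) -> v = w.
Proof.
move=> e; apply/rowP => k; apply/mpolyP => m.
have := e (m + lcms g (enum_val k))%MM (enum_val k).
by rewrite /strand lem_addl addmK !row_chain_val.
Qed.

Lemma strand0 i m s : strand (0 : 'rV[S]_#|faces N i|) m s = 0.
Proof.
by rewrite /strand /row_chain big1 => [|k _]; rewrite ?mxE // mcoeff0 if_same.
Qed.

(** The uniform bound [b] on the multidegrees leaves finitely many coefficients, so the prescribed
    strands assemble into polynomials. *)
Lemma strand_ex i (c : 'X_{1..n} -> {set 'I_N} -> K) b :
    (forall m s, c m s != 0 -> [&& #|s : {set 'I_N}| == i, (lcms g s <= m)%MM & (mdeg m < b)%N]) ->
  exists v : 'rV[S]_#|faces N i|, forall m s, strand v m s = c m s.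
Proof.
move=> hc; exists (\row_k mpoly_of b (fun m => c (m + lcms g (enum_val k))%MM (enum_val k))).
move=> m s; have [/eqP si|si] := boolP (#|s| == i); last first.
  by rewrite strand_card //; apply/esym/eqP; apply: contraNT si => /hc /and3P[].
have [k <-] := facesP si; rewrite /strand row_chain_val mxE mcoeff_mpoly_of.
case: ifPn => [le|nle]; last first.
  by apply/esym/eqP; apply: contraNT nle => /hc /and3P[].
rewrite submK //; case: ltnP => // bm; apply/esym/eqP; apply: contraTT bm => /hc/and3P[_ _ mb].
by rewrite -ltnNge (leq_ltn_trans _ mb) // mdegB.
Qed.

Lemma strand_big i (v : 'rV[S]_#|faces N i|) :
  exists b, forall m s, strand v m s != 0 -> [&& #|s : {set 'I_N}| == i, (lcms g s <= m)%MM & (mdeg m < b)%N].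
Proof.
pose f k := (msize (v 0%R k) + taylor_shift k)%N.
exists (\sum_k f k)%N => m s nz.
have /eqP si : #|s| == i by apply: contraNT nz => /strand_card ->.
rewrite si eqxx /=; move: nz; have [k <-] := facesP si.
rewrite /strand row_chain_val; case: ifP => le; rewrite ?eqxx //= => nz.
have lt : (mdeg (m - lcms g (enum_val k)) < msize (v 0%R k))%N.
  by rewrite ltnNge; apply: contraNN nz => /mcoeff_big_mdeg ->.
apply: (@leq_trans (f k)); last by rewrite (bigD1 k) //= leq_addr.
by rewrite -(submK le) mdegD ltn_add2r.
Qed.

Lemma bd_strand i (v : 'rV[S]_#|faces N i|) m s :
  bd (strand v m) s = \sum_(k < #|faces N i|) incidence K s (enum_val k) * strand v m (enum_val k).
Proof.
rewrite (@eq_bd _ _ _ (row_chain (\row_(k < #|faces N i|) strand v m (enum_val k)))).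
  by rewrite bd_row_chain; apply: eq_bigr => k _; rewrite mxE.
move=> t; have [/eqP ti|ti] := boolP (#|t| == i); first by rewrite row_chain_mk.
by rewrite strand_card // row_chain_card.
Qed.

Lemma mcoeffMX0 (p : S) a m : ~~ (a <= m)%MM -> (p * 'X_[a])@_m = 0.
Proof.
move=> am; apply/eqP; rewrite mcoeff_eq0 (perm_mem (msuppMX _ _)).
by apply: contra am => /mapP[m' _ ->]; apply: lem_addr.
Qed.

(** The monomials in the Taylor differential only adjust for the lcms, so in a fixed multidegree it
    becomes the simplicial boundary. *)
Lemma strand_diff i (v : 'rV[S]_#|faces N i.+1|) m s :
  strand (v *m taylor_diff i) m s = bd (strand v m) s.
Proof.
have [/eqP si|si] := boolP (#|s| == i); last first.
  rewrite strand_card // /bd big1 // => x xs.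
  by rewrite strand_card ?mulr0 // cardsU1 xs eqSS.
have [l sl] := facesP si.
rewrite bd_strand /strand -sl row_chain_val mxE raddf_sum /=.
have -> (le : bool) (F : 'I_#|faces N i.+1| -> K) :
    (if le then \sum_k F k else 0) = \sum_k (if le then F k else 0).
  by case: le; rewrite ?big1_eq.
apply: eq_bigr => k _; rewrite row_chain_val mxE -scalerAr mcoeffZ.
have [->|/incidence_sub/(lcmsS g) le] := eqVneq (incidence K (enum_val l) (enum_val k)) 0.
  by rewrite !mul0r if_same.
have [km|/negbTE km] := boolP (lcms g (enum_val k) <= m)%MM.
  rewrite (lepm_trans le km); congr (_ * _).
  rewrite -[RHS](mcoeffMX _ (lcms g (enum_val k) - lcms g (enum_val l))%MM); congr (_@_ _).
  by apply/mnmP => j; have := lem_coef j le; have := lem_coef j km; rewrite !mnmE; lia.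
rewrite mulr0; case: ifP => // lm; rewrite mcoeffMX0 ?mulr0 //.
apply: contraFN km => /mnm_lepP h; apply/mnm_lepP => j.
by have := h j; rewrite !mnmBE leq_sub2rE // (lem_coef j lm).
Qed.

Lemma taylor_boundary i (w : 'rV[S]_#|faces N i.+2|) :
  w *m taylor_diff i.+1 *m taylor_diff i = 0.
Proof.
apply: eq_strand => m s; rewrite strand_diff strand0 -[RHS](bd_bd (strand w m) s).
by apply: eq_bd => t; apply: strand_diff.
Qed.

(** The strand in multidegree [m] is a complex on the full simplex of generators dividing [m], and
    coning over one of them contracts it. The generator is picked from [m] alone, so one choice
    serves the whole strand. *)
Lemma taylor_exact_strands i (v : 'rV[S]_#|faces N i|) :
    (forall m s, bd (strand v m) s = 0) ->
    (forall m s, strand v m s != 0 -> exists x, (g x <= m)%MM) ->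
  exists w, v = w *m taylor_diff i.
Proof.
move=> cyc supp; pose c m := if [pick x | (g x <= m)%MM] is Some x then cone x (strand v m)
  else fun _ => 0.
have [b hb] := strand_big v.
have [m s|w wE] := @strand_ex i.+1 c b.
  rewrite /c; case: pickP => [x xm|_]; last by rewrite eqxx.
  rewrite /cone; case: ifP => [xs|_]; last by rewrite eqxx.
  move=> nz; have /hb/and3P[/eqP cs ls ->] : strand v m (s :\ x) != 0.
    by apply: contraNneq nz => ->; rewrite mulr0.
  rewrite (cardsD1 x) xs cs eqxx andbT /=.
  by rewrite -(setD1K xs) lcmsU1 lem_mlcm xm.
exists w; apply: eq_strand => m s; rewrite strand_diff (eq_bd _ (wE m)) /c.
case: pickP => [x xm|nox].
  rewrite -[LHS](bd_cone x) [X in _ + X](_ : _ = 0) ?addr0 //.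
  by rewrite /cone cyc mulr0 if_same.
rewrite /bd big1 => [|x _]; last by rewrite mulr0.
by apply/eqP/negPn/negP => /supp[x]; rewrite nox.
Qed.

Lemma taylor_exact i (v : 'rV[S]_#|faces N i.+1|) :
  v *m taylor_diff i = 0 <-> exists w, v = w *m taylor_diff i.+1.
Proof.
split=> [vd|[w ->]]; last exact: taylor_boundary.
apply: taylor_exact_strands => m s; first by rewrite -strand_diff vd strand0.
move=> nz; have /card_gt0P[x xs] : (0 < #|s|)%N.
  by rewrite lt0n; apply: contraNneq nz => s0; rewrite strand_card // s0.
exists x; move: nz; rewrite /strand; case: ifP => [sm _|]; last by rewrite eqxx.
by apply: lepm_trans sm; apply: lcms_ge.
Qed.

Lemma taylor_diff_homog i (k : 'I_#|faces N i.+1|) (l : 'I_#|faces N i|) m :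
  m \in msupp (taylor_diff i k l) -> (taylor_shift l + mdeg m)%N = taylor_shift k.
Proof.
rewrite mxE mcoeff_msupp mcoeffZ mcoeffX.
have [->|/incidence_sub/(lcmsS g) le] := eqVneq (incidence K (enum_val l) (enum_val k)) 0.
  by rewrite mul0r eqxx.
case: (_ =P m) => [<- _|_]; last by rewrite mulr0 eqxx.
by rewrite addnC -mdegD submK.
Qed.

Variable I : idealr S.
Hypothesis genI : forall f : S, f \in I <-> forall m, m \in msupp f -> exists x, (g x <= m)%MM.

Lemma homog_ideal j (p : S) : p \in I -> hpart j 0 p \in I.
Proof.
move/genI => h; apply/genI => m; rewrite mcoeff_msupp mcoeff_hpart.
by case: (_ =P j); rewrite ?eqxx // -mcoeff_msupp => _ /h.
Qed.

Let gen (k : 'I_#|faces N 0|) : quot_module I := quot_class I 1.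

Lemma taylor_gen_homog k : @quot_piece K n I (taylor_shift k) (gen k).
Proof.
exists 1 => //; rewrite /taylor_shift.
have := enum_valP k; rewrite inE cards_eq0 => /eqP ->.
by rewrite lcms0 mdeg0; apply: dhomog1.
Qed.

Lemma sum_taylor_gen (v : 'rV[S]_#|faces N 0|) : \sum_k v 0 k *: gen k = quot_class I (\sum_k v 0 k).
Proof. by rewrite quot_class_sum; congr quot_class; apply: eq_bigr => k _; rewrite mulr1. Qed.

Lemma card_faces0 : #|faces N 0| = 1%N.
Proof.
rewrite (_ : faces N 0 = [set set0]) ?cards1 //.
by apply/setP => s; rewrite !inE cards_eq0.
Qed.

Lemma taylor_aug_surj (x : quot_module I) :
  exists v : 'rV[S]_#|faces N 0|, \sum_k v 0 k *: gen k = x.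
Proof.
exists (const_mx (repr (x : {ideal_quot I}))); rewrite sum_taylor_gen.
rewrite (eq_bigr (fun _ => repr (x : {ideal_quot I}))) => [|k _]; last by rewrite mxE.
by rewrite sumr_const card_ord card_faces0; apply: reprK.
Qed.

Lemma row_chain_set0 (v : 'rV[S]_#|faces N 0|) : row_chain v set0 = \sum_k v 0 k.
Proof.
apply: eq_bigl => k; have := enum_valP k.
by rewrite inE cards_eq0.
Qed.

Lemma strand_set0 (v : 'rV[S]_#|faces N 0|) m : strand v m set0 = (\sum_k v 0 k)@_m.
Proof. by rewrite /strand lcms0 lem0 subm0 row_chain_set0. Qed.

Lemma taylor_exact0 (v : 'rV[S]_#|faces N 0|) :
  \sum_k v 0 k *: gen k = 0 <-> exists w, v = w *m taylor_diff 0.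
Proof.
rewrite sum_taylor_gen quot_class_eq0 genI; split=> [h|[w ->] m].
  apply: taylor_exact_strands => m s.
    rewrite /bd big1 // => x xs; rewrite strand_card ?mulr0 //.
    by rewrite cardsU1 xs.
  have [/eqP/cards0_eq ->|s0] := boolP (#|s| == 0%N); last by rewrite strand_card ?eqxx.
  by rewrite strand_set0 -mcoeff_msupp => /h.
rewrite mcoeff_msupp -strand_set0 strand_diff => nz.
suff /existsP[x xm] : [exists x, (g x <= m)%MM] by exists x.
apply: contraNT nz => /existsPn nox; rewrite /bd big1 // => x _.
rewrite /strand lcmsU1 lem_mlcm (negPf (nox x)) mulr0 //.
Qed.

Definition taylor_resolution : graded_free_resolution (@quot_piece K n I) :=
  GradedFreeResolution taylor_diff_homog taylor_gen_homog taylor_aug_surj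
    taylor_exact0 taylor_exact.

(** * Betti numbers from the Taylor resolution *)

Local Notation T := taylor_resolution.

Definition degree_faces j : {set {set 'I_N}} := [set s : {set 'I_N} | mdeg (lcms g s) == j].

(** Modulo the variables only entries between sets with the same lcm survive. For nested sets equal
    degree forces equal lcm, so in degree [j] nothing of the simplicial boundary is lost. *)
Lemma tensor_taylor_entry i j (z : 'rV[K]_#|faces N i.+1|) (l : 'I_#|faces N i|) :
    in_degree (@taylor_shift i.+1) j z -> enum_val l \in degree_faces j ->
  (z *m map_mx (mcoeff 0%MM) (taylor_diff i)) 0 l = bd (row_chain z) (enum_val l).
Proof.
move=> hz; rewrite inE => /eqP lj; rewrite bd_row_chain mxE; apply: eq_bigr => k _.
rewrite !mxE mcoeffZ mcoeffX mulrC.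
have [->|/hz kj] := eqVneq (z 0 k) 0; first by rewrite !mulr0.
have [->|/incidence_sub/(lcmsS g) le] := eqVneq (incidence K (enum_val l) (enum_val k)) 0.
  by rewrite !mul0r.
rewrite (_ : lcms g (enum_val k) = lcms g (enum_val l)) ?submm ?eqxx ?mulr1 //.
by apply/esym/(lem_mdeg_eq le); rewrite lj -kj.
Qed.

Lemma row_chain_degree i j (z : 'rV[K]_#|faces N i|) :
  in_degree (@taylor_shift i) j z -> chain_on (degree_faces j) i (row_chain z).
Proof.
move=> hz s; have [/eqP si|si] := boolP (#|s| == i); last by rewrite row_chain_card ?eqxx.
by have [k <-] := facesP si; rewrite row_chain_val andbT inE => /hz <-.
Qed.

Lemma chain_row_degree i j (c : {set 'I_N} -> K) : chain_on (degree_faces j) i c ->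
  in_degree (@taylor_shift i) j (\row_(k < #|faces N i|) c (enum_val k)) /\
  row_chain (\row_(k < #|faces N i|) c (enum_val k)) =1 c.
Proof.
move=> hc; split=> [k|s]; first by rewrite mxE => /hc/andP[+ _]; rewrite inE => /eqP.
have [/eqP si|si] := boolP (#|s| == i); first by rewrite row_chain_mk.
by rewrite row_chain_card //; apply/esym/eqP; apply: contraNT si => /hc /andP[].
Qed.

Lemma bd_card i j (c : {set 'I_N} -> K) (s : {set 'I_N}) : chain_on (degree_faces j) i.+1 c -> #|s| != i ->
  bd c s = 0.
Proof.
move=> hc si; rewrite /bd big1 // => x xs; have [->|/hc/andP[_]] := eqVneq (c (x |: s)) 0.
  by rewrite mulr0.
by rewrite cardsU1 xs eqSS (negPf si).
Qed.

Lemma tensor_taylor_degree i j (z : 'rV[K]_#|faces N i.+1|) (l : 'I_#|faces N i|) :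
    in_degree (@taylor_shift i.+1) j z -> enum_val l \notin degree_faces j ->
  (z *m map_mx (mcoeff 0%MM) (taylor_diff i)) 0 l = 0.
Proof.
move=> hz; rewrite inE => lj; apply/eqP; apply: contraNT lj => nz; apply/eqP.
by apply: (in_degree_mul (s := @taylor_shift i.+1) (s' := @taylor_shift i) _ hz nz) => k l' m;
   apply: taylor_diff_homog.
Qed.

Lemma taylor_betti_acyclic i j : betti T i j = 0%N <-> acyclic K (degree_faces j) i.
Proof.
rewrite betti_eq0; split=> [h c hc cc|h z hz cz].
  have [hz zE] := chain_row_degree hc; set z := (X in in_degree _ _ X) in hz zE.
  have cz : @tcycle K n I T i z.
    case: i {h} c hc cc @z hz zE => [//|i] c hc cc z hz zE; rewrite /tcycle; apply/rowP => l; rewrite [RHS]mxE.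
    have [lj|lj] := boolP (enum_val l \in degree_faces j).
      by rewrite (tensor_taylor_entry hz lj) (eq_bd _ zE) cc.
    by apply: tensor_taylor_degree lj.
  have [w hw wE] := h z hz cz.
  exists (row_chain w) => [|s sj]; first exact: row_chain_degree.
  have [/eqP si|si] := boolP (#|s| == i); last first.
    rewrite (bd_card (row_chain_degree hw) si); apply/esym/eqP.
    by apply: contraNT si => /hc/andP[].
  have [k sk] := facesP si; rewrite -sk in sj *.
  by rewrite -(tensor_taylor_entry hw sj) -[RHS]zE [RHS]row_chain_val -[LHS]/((w *m tensor_diff T i) 0 k) -wE.
have hc := row_chain_degree hz.
have [s sj|w hw wE] := h _ hc.
  (* In homological degree 0 every chain is a cycle: it lives on the empty set, which has no proper
     faces. *)
  case: i z hz cz {h} hc => [|i] z hz cz hc.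
    rewrite /bd big1 // => x xs; rewrite row_chain_card ?mulr0 //.
    by rewrite cardsU1 xs.
  have [/eqP si|si] := boolP (#|s| == i); last exact: bd_card hc si.
  have [k sk] := facesP si; rewrite -sk in sj *.
  by rewrite -(tensor_taylor_entry hz sj) [LHS](congr1 (fun v : 'rV_ _ => v 0 k) cz) mxE.
have [hv vE] := chain_row_degree hw; exists (\row_(k < #|faces N i.+1|) w (enum_val k)) => //.
apply/rowP => l; have [lj|lj] := boolP (enum_val l \in degree_faces j).
  rewrite [RHS](tensor_taylor_entry hv lj) (eq_bd _ vE) wE //.
  by rewrite row_chain_val.
rewrite [RHS](tensor_taylor_degree hv lj); apply/eqP; apply: contraNT lj => /hz.
by rewrite inE => <-.
Qed.

(** Nested sets whose lcms have the same degree have the same lcm, so each multigraded strand is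
    both down-closed and up-closed in the degree [j] family. *)
Lemma degree_faces_acyclic i j : acyclic K (degree_faces j) i <->
  forall m, mdeg m = j -> acyclic K (lcm_fibre g 0%MM m) i.
Proof.
have cX : convex (degree_faces j).
  move=> r s t; rewrite !inE => /eqP rj /eqP tj rs st; rewrite eqn_leq.
  by rewrite -{1}tj -rj !lem_mdeg ?lcmsS.
split=> [h m mj|h].
  apply: acyclic_summand h.
  - by apply/subsetP => s; rewrite !inE mlc0m => /eqP ->; rewrite mj.
  - move=> s t; rewrite !inE !mlc0m => /eqP sm /eqP tj ts.
    by apply/eqP/lem_mdeg_eq; rewrite ?tj ?mj // -sm lcmsS.
  move=> s t; rewrite !inE !mlc0m => /eqP sm /eqP tj st.
  by apply/eqP/esym/lem_mdeg_eq; rewrite ?tj ?mj // -sm lcmsS.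
apply: (@acyclic_fibres _ _ _ (fun s => mlcm 0%MM (lcms g s)) (@mdeg n)) => //.
  by move=> s t _ _; apply: lcm_fibre_mono.
move=> s sj; rewrite (_ : [set t in _ | _] = lcm_fibre g 0%MM (lcms g s)).
  by apply: h; move: sj; rewrite inE => /eqP.
apply/setP => t; rewrite !inE !mlc0m; case: (lcms g t =P lcms g s) => [->|_].
  by move: sj; rewrite inE andbT.
by rewrite andbF.
Qed.

Lemma betti_eq0_lcm (F : graded_free_resolution (@quot_piece K n I)) i j :
  betti F i j = 0%N <-> forall m, mdeg m = j -> acyclic K (lcm_fibre g 0%MM m) i.
Proof.
rewrite -degree_faces_acyclic -taylor_betti_acyclic.
by split; apply: betti_eq0_transfer; apply: homog_ideal.
Qed.
End Taylor.

(** * Maximal shifts *)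

Section MinimalGenerators.
Variables (K : fieldType) (n d : nat) (I : idealr {mpoly K[n]}).
Hypothesis hmon : monomial_ideal I.
Hypothesis hd : forall m, minimal_generator I m -> (mdeg m <= d)%N.

Lemma minimal_generator_below m : 'X_[m] \in I ->
  exists2 m', minimal_generator I m' & (m' <= m)%MM.
Proof.
have [k] := ubnP (mdeg m); elim: k m => // k IH m mk mI.
have [h|h] := classic (exists m', [/\ (m' <= m)%MM, 'X_[m'] \in I & m' <> m]).
  have [m' [m'm m'I ne]] := h.
  have [|m2 h2 le] := IH m' _ m'I; last by exists m2 => //; apply: lepm_trans m'm.
  rewrite -ltnS (leq_trans _ mk) // ltnS ltn_neqAle lem_mdeg // andbT.
  by apply/eqP => /(lem_mdeg_eq m'm).
exists m; last exact: lepm_refl.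
by split=> // m' m'm m'I; apply: NNPP => ne; apply: h; exists m'.
Qed.

(** The bound [d] makes this a finite type. Testing only the [m'] of degree at most [d] suffices,
    since every divisor of [m] is among them. *)
Definition min_gens : {set 'X_{1..n < d.+1}} :=
  [set m : 'X_{1..n < d.+1} | ('X_[m] \in I) &&
    [forall m' : 'X_{1..n < d.+1}, (m' <= m)%MM ==> ('X_[m'] \in I) ==> (m' == m)]].

Definition min_gen (x : 'I_#|min_gens|) : 'X_{1..n} := enum_val x.

Lemma min_gen_minimal x : minimal_generator I (min_gen x).
Proof.
have := enum_valP x; rewrite inE => /andP[xI /forallP h]; split=> // m mx mI.
have md : (mdeg m < d.+1)%N by apply: leq_ltn_trans (lem_mdeg mx) (bmdeg _).
by have := h (BMultinom md); rewrite /= mx mI /= => /eqP/(congr1 val).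
Qed.

Lemma min_gen_anti x y : (min_gen x <= min_gen y)%MM -> x = y.
Proof.
move=> xy; apply/enum_val_inj/val_inj.
by have [_ h] := min_gen_minimal y; apply: h => //; case: (min_gen_minimal x).
Qed.

Lemma min_gen_ex m : 'X_[m] \in I -> exists x, (min_gen x <= m)%MM.
Proof.
move=> /minimal_generator_below[m' h m'm].
have md : (mdeg m' < d.+1)%N by rewrite ltnS hd.
have sG : BMultinom md \in min_gens.
  rewrite inE /=; case: h => -> h; apply/forallP => m2; apply/implyP => le; apply/implyP => m2I.
  by apply/eqP/val_inj/h.
by exists (enum_rank_in sG (BMultinom md)); rewrite /min_gen enum_rankK_in.
Qed.

Lemma mem_monomial_ideal (f : {mpoly K[n]}) :
  f \in I <-> forall m, m \in msupp f -> exists x, (min_gen x <= m)%MM.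
Proof.
split=> [fI m|h].
  have [A IA] := hmon; have [s [sA ->]] := (IA f).1 fI.
  rewrite mcoeff_msupp raddf_sum /= => nz.
  have /hasP[u us] : has (fun u => (u.1 * 'X_[u.2])@_m != 0) s.
    apply: contraNT nz => /hasPn h; rewrite big1_seq // => u /andP[_ /h /=].
    by rewrite negbK => /eqP.
  rewrite -mcoeff_msupp (perm_mem (msuppMX _ _)) => /mapP[m' _ ->].
  have [|x xu] := @min_gen_ex u.2; last by exists x; apply: lepm_trans xu (lem_addr _ _).
  apply/IA; exists [:: (1, u.2)]; split=> [v|]; last by rewrite big_seq1 mul1r.
  by rewrite mem_seq1 => /eqP ->; exact: (sA u us).
rewrite (mpolyE f) big_seq; apply: rpred_sum => m /h[x xm].
have [xI _] := min_gen_minimal x.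
by rewrite -mul_mpolyC -(submK xm) mpolyXD mulrA idealMr.
Qed.
End MinimalGenerators.

Section MaximalShifts.
Variables (K : fieldType) (n e d : nat) (I : idealr {mpoly K[n]}).
Variable F : graded_free_resolution (@quot_piece K n I).
Hypothesis hed : (2 <= e <= d)%N.
Hypothesis hmon : monomial_ideal I.
Hypothesis hgen : forall m, minimal_generator I m -> (e <= mdeg m <= d)%N.

Let g := @min_gen K n d I.
(** Tor_i(S/I, K) is nonzero in multidegree [m]. *)
Let H i m := ~ acyclic K (lcm_fibre g 0%MM m) i.
Local Notation t := (max_shift F).

Let gd x : (e <= mdeg (g x) <= d)%N.
Proof. exact/hgen/min_gen_minimal. Qed.

Let hd m : minimal_generator I m -> (mdeg m <= d)%N.
Proof. by case/hgen/andP. Qed.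

Lemma mdeg_le_max_shift i m : H i m -> (mdeg m <= t i)%N.
Proof.
move=> h; apply: max_shift_ge; apply/eqP => /(betti_eq0_lcm (mem_monomial_ideal hmon hd)) b0.
by apply: h; apply: b0.
Qed.

Lemma max_shift_multidegree i : (0 < t i)%N -> exists2 m, H i m & mdeg m = t i.
Proof.
(* Positivity excludes the default value 0 of the empty maximum. *)
move=> ti; have bn : betti F i (t i) != 0%N.
  have [[j bj]|h] := classic (exists j, betti F i j != 0%N).
    exact: max_shift_attained bj.
  move: ti; rewrite /max_shift big_pred0 // => k.
  by apply/negbTE/negP => bk; apply: h; exists (gf_shift k).
apply: NNPP => h; case/eqP: bn; apply/(betti_eq0_lcm (mem_monomial_ideal hmon hd)) => m mt.
by apply: NNPP => nac; apply: h; exists m.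
Qed.

Lemma max_shift_step i : (t i.+1 <= t i + d)%N.
Proof.
have [->//|/max_shift_multidegree[m hm <-]] := posnP (t i.+1).
have [s] := chain_of_not_acyclic hm; rewrite inE mlc0m => /eqP sm cs.
have /card_gt0P[x xs] : (0 < #|s|)%N by rewrite cs.
have xm : (g x <= m)%MM by rewrite -sm lcms_ge.
have [m' [_ _ em /mdeg_le_max_shift]] := lcm_fibre_peelN xm hm.
by have := mdeg_lcm_gcd m' (g x); have := gd x; rewrite em; lia.
Qed.

Lemma max_shift_two_step a i : (t a < a * e)%N -> (a <= i.+2)%N ->
  (t i.+2 < t i + d + d)%N.
Proof.
move=> ta ai; rewrite ltnNge; apply/negP => h.
have [|m hm mt] := @max_shift_multidegree i.+2; first by lia.
have e0 : (0 < e)%N by lia.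
(* A jump of 2d makes both single jumps from [i] to [i.+2] tight, so the lower bound produces a
   shift of at least a e in homological degree [a], against [ta]. *)
have [m'||m' /mdeg_le_max_shift] := tight_lower_bound (@min_gen_anti K n d I) gd e0 hm _ _ ai.
- by move=> /mdeg_le_max_shift; have := max_shift_step i; rewrite mt; lia.
- by move=> m' /mdeg_le_max_shift; rewrite mt; lia.
by lia.
Qed.

Lemma max_shift_gain a b : (t a < a * e)%N -> (t (a + b) + b./2 <= t a + d * b)%N.
Proof.
move=> ta; have [k] := ubnP b; elim: k b => // k IH [|[|b]] bk.
- by rewrite addn0 muln0.
- by rewrite addn1 muln1 addn0 max_shift_step.
(* Two further steps raise the shift by at most 2d - 1, while the half of the index grows by exactly
   1. *)
have lt := @max_shift_two_step a (a + b) ta (leqW (leqW (leq_addr _ _))).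
by have := IH b (ltnW bk); move: lt; rewrite -[b.+2./2]/(b./2).+1 !addnS !mulnS; lia.
Qed.
End MaximalShifts.

Theorem corollary4p1 (K : fieldType) (n e d : nat) (I : idealr {mpoly K[n]})
    (F : graded_free_resolution (@quot_piece K n I)) (p : nat)
    (hed : (2 <= e <= d)%N)
    (hmon : monomial_ideal I)
    (hgen : forall m, minimal_generator I m -> (e <= mdeg m <= d)%N)
    (hp : projective_dimension (quot_module I) p) :
  let t := max_shift F in
  let delta (i : nat) : int := (d * i)%:Z - (t i)%:Z in
  forall a : nat, (2 <= a <= p)%N -> (t a < a * e)%N ->
  forall b : nat, (b <= p - a)%N ->
  [/\ delta a + (b./2)%:Z <= delta (a + b)%N,
      a%:Z * (d%:Z - e%:Z) + 1 + (b./2)%:Z <= delta a + (b./2)%:Z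
    & (t (a + b)%N)%:Z <= a%:Z * e%:Z + d%:Z * b%:Z - 1 - (b./2)%:Z].
Proof.
move=> t delta a _ ta b _; have gain := max_shift_gain hed hmon hgen b ta.
rewrite /delta; move: gain (ta); rewrite -/t.
move: (t (a + b)%N) (t a) => tab ta'.
(* The first inequality is [gain], the second is t_a <= ae - 1, and the third is their
   combination. *)
by split; nia.
Qed.
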